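(* The reindexed Pieri support on $S_N$ has $2^N-N$ weak connected components. Every component contains exactly one element of $$\mathcal A_N^+=\mathrm{Av}_N(132,2341,3124)$$ and exactly one element of $$\mathcal A_N^-=\mathrm{Av}_N(213,2341,1423);$$ these are respectively a source and a sink of the directed reindexed Pieri support.
   Context: $\mathrm{Av}_N(p_1,\dots,p_k)$ is the set of permutations in $S_N$ avoiding all the patterns $p_i$. The Lehmer code of $\pi\in S_N$ is $L(\pi)_i=\#\{j>i:\pi_i>\pi_j\}$. $\mathfrak S_\sigma(x)$ is the classical Schubert polynomial. The (directed, $w_0$-reindexed) Pieri support is the directed graph on $S_N$ with an edge $\pi\to\sigma$, for $\pi\ne\sigma$, whenever $[x^{L(\pi)}]\mathfrak S_\sigma(x)>0$. Equivalently, $\pi\to\sigma$ iff $\pi\neq\sigma$ and $\Pi_N(\pi w_0,\sigma w_0)\ne0$, where $w_0$ is the longest permutation and $\Pi_N$ is the matrix with $\prod_{j=2}^Ne_{e_j(w)}(x_1,\dots,x_{j-1})=\sum_u\Pi_N(w,u)\mathfrak S_u(x)$, $e_j(w)=\#\{i<j:w_i>w_j\}$. Weak components are the connected components of the underlying undirected graph. A source is a vertex with no incoming edge, a sink a vertex with no outgoing edge. *)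

(* Defs.v *)
From mathcomp Require Import all_boot all_order all_fingroup all_algebra.
From mathcomp Require Import mpoly.

Set Implicit Arguments.
Unset Strict Implicit.
Unset Printing Implicit Defensive.

Import GRing.Theory.
Local Open Scope ring_scope.

(* A permutation w in S_n is an element of 'S_n, with positions, values and    *)
(* variables numbered 0, ..., n-1; its one-line notation is w 0, ..., w (n-1). *)

Definition lehmer (n : nat) (w : 'S_n) : 'X_{1..n} :=
  [multinom #|[set j : 'I_n | (i < j)%N && (w j < w i)%N]| | i < n].

(* The divided difference (f - s_ij f) / (X_i - X_j): the quotient exists, and *)
(* it is unique for i != j since {mpoly int[n]} is an integral domain.         *)
Lemma ddiff_exists (n : nat) (i j : 'I_n) (f : {mpoly int[n]}) :
  exists g : {mpoly int[n]}, ('X_i - 'X_j) * g == f - msym (tperm i j) f.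
Proof.
pose P f := exists g : {mpoly int[n]}, ('X_i - 'X_j) * g = f - msym (tperm i j) f.
suff [g gE] : P f by exists g; apply/eqP.
have PD p q : P p -> P q -> P (p + q).
  by case=> g gE [h hE]; exists (g + h); rewrite mulrDr gE hE msymD addrACA opprD.
have PZ c p : P p -> P (c *: p).
  by case=> g gE; exists (c *: g); rewrite -scalerAr gE msymZ scalerBr.
have PM p q : P p -> P q -> P (p * q).
  case=> g gE [h hE]; exists (g * msym (tperm i j) q + p * h).
  rewrite mulrDr mulrA gE mulrCA hE msymM mulrBl mulrBr.
  by rewrite addrC addrA subrK.
have P1 : P 1 by exists 0; rewrite mulr0 (rmorph1 (msym (tperm i j))) subrr.
have PX k : P 'X_k.
  have symX : msym (tperm i j) 'X_k = 'X_(tperm i j k) :> {mpoly int[n]}.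
    rewrite msymX; congr 'X_[_]; apply/mnmP=> l; rewrite !mnmE tpermV.
    by rewrite -(inj_eq (@perm_inj _ (tperm i j))) tpermK.
  rewrite /P symX; case: tpermP => [->|->|_ _]; first by exists 1; rewrite mulr1.
    by exists (-1); rewrite mulrN1 opprB.
  by exists 0; rewrite mulr0 subrr.
rewrite (mpolyE f); apply: (big_ind P).
- by exists 0; rewrite mulr0 (raddf0 (msym (tperm i j))) subrr.
- exact: PD.
move=> m _; apply: PZ; rewrite mpolyXE_id.
apply: (big_ind P) => // k _.
by elim: (m k) => [|d IHd]; rewrite ?expr0 // exprS; apply: PM.
Qed.

Definition ddiff (n : nat) (i j : 'I_n) (f : {mpoly int[n]}) : {mpoly int[n]} :=
  xchoose (ddiff_exists i j f).

(* The classical recursion: S_{w_0} = x_1^{n-1} x_2^{n-2} ... x_{n-1}, and     *)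
(* S_w = d_i S_{w s_i} whenever w_i < w_{i+1}. By the braid relations the      *)
(* result does not depend on the chosen ascent. Each step adds one inversion,  *)
(* so k := 'C(n, 2) suffices to reach w_0, the only w without an ascent.       *)
(* The product of permutations is (s * t) x = t (s x), so w s_i (exchanging    *)
(* the entries in positions i and i+1) is tperm i (i+1) * w.                   *)
Fixpoint schubert_rec (n k : nat) (w : 'S_n) {struct k} : {mpoly int[n]} :=
  let top := 'X_[[multinom (n - i.+1)%N | i < n]] in
  if k is k'.+1 then
    if [pick p : 'I_n * 'I_n | (p.2 == p.1.+1 :> nat) && (w p.1 < w p.2)%N]
      is Some p
    then ddiff p.1 p.2 (schubert_rec k' (tperm p.1 p.2 * w)%g)
    else top
  else top.

Definition schubert (n : nat) (w : 'S_n) : {mpoly int[n]} :=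
  schubert_rec 'C(n, 2) w.

(* A pattern is given in one-line notation; only its relative order matters. *)
Definition contains (n : nat) (w : 'S_n) (p : seq nat) : bool :=
  [exists f : {ffun 'I_(size p) -> 'I_n},
    [forall a : 'I_(size p), forall b : 'I_(size p), ((a < b)%N ==> (f a < f b)%N) &&
      ((w (f a) < w (f b))%N == (nth 0%N p a < nth 0%N p b)%N)]].

Definition Av (n : nat) (ps : seq (seq nat)) : {set 'S_n} :=
  [set w | all (fun p => ~~ contains w p) ps].

Definition Aplus (n : nat) : {set 'S_n} :=
  Av n [:: [:: 1; 3; 2]; [:: 2; 3; 4; 1]; [:: 3; 1; 2; 4]]%N.

Definition Aminus (n : nat) : {set 'S_n} :=
  Av n [:: [:: 2; 1; 3]; [:: 2; 3; 4; 1]; [:: 1; 4; 2; 3]]%N.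

Definition pieri_edge (n : nat) : rel 'S_n :=
  fun u w => (u != w) && (0 < (schubert w)@_(lehmer u)).

Definition weak_components (n : nat) : {set {set 'S_n}} :=
  equivalence_partition
    (connect [rel u w | pieri_edge u w || pieri_edge w u]) [set: 'S_n].

Definition is_source (n : nat) (w : 'S_n) : Prop :=
  forall u : 'S_n, ~~ pieri_edge u w.

Definition is_sink (n : nat) (w : 'S_n) : Prop :=
  forall u : 'S_n, ~~ pieri_edge w u.

(* Main.v *)
Require Import Defs.
From mathcomp Require Import all_boot all_order all_fingroup all_algebra.
From mathcomp Require Import mpoly.
From mathcomp Require Import zify ring.

(** Encode a permutation [w] by the word [c] whose letter [c_i] counts the
    [j > i] with [w_j > w_i]; it is the complement of the Lehmer code in the
    staircase, and the words obtained are exactly those in which each letter is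
    at most the number of letters after it. Exponents below the staircase are
    encoded in the same way. All monomials of a Schubert polynomial lie below
    the staircase, so an edge [u -> w] says that the word of [u] is the word of a
    monomial of the Schubert polynomial of [w].

    The invariant. Read a word as a walk with steps [c_i - 1] and mark the
    positions where the walk reaches a new strict minimum. The profile of the
    word consists of the marks and of the final height above the minimum. In
    terms of words, a divided difference replaces two adjacent letters [p], [q]
    by letters [x > 0] and [y] with [x + y = p + q + 1]. Whatever [x] is, this
    erases the first mark at or after this position, and raises the final height
    by one when there is no such mark. By induction all monomials of a Schubert
    polynomial have the profile of its permutation ([schubert_profile]), so the
    profile is constant on weak components.

    Connectedness. The word of [w] is the lexicographically largest word of a
    monomial of its Schubert polynomial, and occurs with coefficient 1
    ([schubert_lex], [schubert_lead]). If [w_i < w_(i+1)], the polynomial is a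
    divided difference of another Schubert polynomial, and this triangularity
    makes its coefficients constant, hence 1, on the string of monomials from
    the leading one to its mirror image under the exchange of the two variables
    ([schubert_string]). Consequently a component contains, with a word, every
    word obtained by moving units between two adjacent letters while the first
    of them stays positive. These moves connect any two words with the same
    profile ([linked_profile]): before the first mark, units can be spread until
    all letters are positive, and positive words of the same length and sum are
    connected. Thus weak components correspond to profiles ([connect_profile]).
    The argument uses the defining recursion of Schubert polynomials at every
    ascent, which the braid relations provide ([schubert_ascent]).

    Counting. A profile is a set of marks together with a final height, and the
    heights available after the last mark fill an interval. The recursion on the
    first letter then gives [2 ^ N - N] profiles ([size_profiles]).

    Representatives. The words of the permutations in [Aminus N] are made of
    blocks [k 0 ... 0] with [k] zeros followed by a word that is filled greedily
    from the left; they are the lexicographically largest words of their profile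
    ([minus_lexmax]). Each profile has exactly one, and it is a sink since an
    edge strictly increases the word. The words of the permutations in [Aplus N]
    are made of blocks [1 ... 1 0] followed by a word that is as flat as
    possible. Their letters never drop by more than one, hence their Schubert
    polynomial is a single monomial ([schubert_dominant]) and they are sources. *)

Set Implicit Arguments.
Unset Strict Implicit.
Unset Printing Implicit Defensive.

(** * Bounded words and their profiles *)

(** These are the words [c_i = #{j > i : w_j > w_i}] of the permutations [w]. *)
Fixpoint bounded (c : seq nat) : bool :=
  if c is x :: c' then (x <= size c') && bounded c' else true.

(** The walk with steps [x - 1], started at height [g] above its current
    minimum. The truncated predecessor resets the height to 0 at a new minimum,
    which happens exactly when [g + x = 0]. *)
Fixpoint records (g : nat) (c : seq nat) : bitseq :=
  if c is x :: c' then (g + x == 0) :: records (g + x).-1 c' else [::].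

Fixpoint height (g : nat) (c : seq nat) : nat :=
  if c is x :: c' then height (g + x).-1 c' else g.

(** The invariant that separates the weak components. *)
Definition profile c := (records 0 c, height 0 c).

Lemma bounded_catr e c : bounded (e ++ c) -> bounded c.
Proof. by elim: e => //= x e IHe /andP[_ /IHe]. Qed.

Lemma bounded_cat_swap e c d :
  size c = size d -> bounded d -> bounded (e ++ c) -> bounded (e ++ d).
Proof.
move=> sz bd; elim: e => //= x e IHe /andP[lex /IHe ->].
by rewrite andbT; move: lex; rewrite !size_cat sz.
Qed.

Lemma bounded_zeros m c : bounded c -> bounded (nseq m 0 ++ c).
Proof. by elim: m. Qed.

Lemma sumn_bounded c : bounded c -> (sumn c <= 'C(size c, 2))%N.
Proof.
elim: c => //= x c IHc /andP[lex /IHc le]; rewrite binS bin1; lia.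
Qed.

Lemma records_cat g c d :
  records g (c ++ d) = records g c ++ records (height g c) d.
Proof. by elim: c g => //= x c IHc g; rewrite IHc. Qed.

Lemma height_cat g c d : height g (c ++ d) = height (height g c) d.
Proof. by elim: c g => //=. Qed.

Lemma size_records g c : size (records g c) = size c.
Proof. by elim: c g => //= x c IHc g; rewrite IHc. Qed.

(** Without a new minimum no step is truncated. *)
Lemma height_sumn g c :
  true \notin records g c -> height g c + size c = g + sumn c.
Proof.
elim: c g => [|x c IHc] g /=; first by rewrite !addn0.
rewrite inE; have [//|gx] := eqVneq (g + x) 0 => /IHc E; lia.
Qed.

Lemma profile_sumn g c : height g c + size c = g + sumn c + count id (records g c).
Proof.
elim: c g => [|x c IHc] g /=; first by rewrite !addn0.
by have := IHc (g + x).-1; case: eqVneq; lia.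
Qed.

Lemma profile_eq_sumn c d : size c = size d -> profile c = profile d -> sumn c = sumn d.
Proof. by move=> sz [Er Eh]; have := profile_sumn 0 c; have := profile_sumn 0 d; rewrite Er Eh sz; lia. Qed.

Lemma nseq_false b : true \notin b -> b = nseq (size b) false.
Proof. by elim: b => //= -[] // b IHb; rewrite inE => /IHb <-. Qed.

Lemma sumn_pos d : all (leq 1) d -> size d <= sumn d.
Proof. by elim: d => //= x d IHd /andP[x0 /IHd]; lia. Qed.

Lemma all_ones d : all (leq 1) d -> sumn d = size d -> d = nseq (size d) 1.
Proof.
elim: d => //= x d IHd /andP[x0 pd] E; have := sumn_pos pd => le.
have x1 : x = 1 by lia.
by rewrite x1 -IHd //; lia.
Qed.

Lemma nseq_true_inj a b (s t : bitseq) :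
  nseq a false ++ true :: s = nseq b false ++ true :: t -> a = b /\ s = t.
Proof. by elim: a b => [|a IHa] [|b] //= [] => [->|/IHa[-> ->]]. Qed.

(** The first new minimum cuts a word into a prefix whose letters sum to its
    length, a letter 0, and a suffix that the walk reads afresh. *)
Lemma records_split c : true \in records 0 c ->
  exists d s, [/\ c = d ++ 0 :: s, records 0 c = nseq (size d) false ++ true :: records 0 s,
                 height 0 c = height 0 s, true \notin records 0 d & sumn d = size d].
Proof.
move=> rec.
have [d [x [s [cE nr hx]]]] : exists d x s, [/\ c = d ++ x :: s, true \notin records 0 d &
    height 0 d + x = 0].
  elim/last_ind: c rec => // c x IHc; rewrite -cats1 records_cat mem_cat.
  have [/IHc[d [y [s [-> nr hy]]]] _|nr] := boolP (true \in records 0 c).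
    by exists d, y, (s ++ [:: x]); rewrite -catA.
  rewrite /= inE => hx; exists c, x, [::]; split=> //.
  by apply/eqP; case: eqP hx.
have [h0 x0] : height 0 d = 0 /\ x = 0 by lia.
have := height_sumn nr; rewrite h0 !add0n => sz.
exists d, s; rewrite cE x0 records_cat height_cat /= h0; split=> //; congr (_ ++ _).
rewrite -(size_records 0 d); elim: (records 0 d) nr => //= -[] // b IHb.
by rewrite inE => /IHb <-.
Qed.

Lemma profile_block e c : true \notin records 0 e -> sumn e = size e ->
  profile (e ++ 0 :: c) = (nseq (size e) false ++ true :: records 0 c, height 0 c).
Proof.
move=> nr se; have := height_sumn nr; rewrite se add0n => h0.
have {}h0 : height 0 e = 0 by lia.
by rewrite /profile records_cat height_cat h0 (nseq_false nr) size_records.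
Qed.

Lemma records_positive g d : all (leq 1) d -> true \notin records g d.
Proof.
elim: d g => //= x d IHd g /andP[x0 /IHd pd]; rewrite inE negb_or pd andbT.
by have -> : (g + x == 0) = false by lia.
Qed.

Lemma records_zeros g m : m <= g -> true \notin records g (nseq m 0).
Proof.
elim: m g => //= m IHm [|g] //; rewrite addn0 inE /= => lt.
by apply: IHm; lia.
Qed.

Fixpoint clear_first (b : bitseq) : bitseq :=
  if b is x :: b' then false :: (if x then b' else clear_first b') else [::].

(** Started one unit higher, the walk does not fall below its minimum at the
    first mark, and from there on it agrees with the original walk. *)
Lemma records_heightS g c :
  records g.+1 c = clear_first (records g c) /\
  height g.+1 c = (height g c + (true \notin records g c))%N.
Proof.
elim: c g => [|x c IHc] g /=; first by rewrite addn1.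
rewrite addSn /=; case: (g + x)%N => [|h] /=; first by rewrite addn0.
by have [-> ->] := IHc h; rewrite inE.
Qed.

(** The effect of a divided difference on the profile. It does not depend on
    [x]: after the two letters the walk is one unit higher than before, unless
    these letters carried a mark, the first of which is then erased. *)
Lemma records_height_exchange g p q x y r : (x + y = (p + q).+1)%N -> (0 < x)%N ->
  records g (x :: y :: r) = clear_first (records g (p :: q :: r)) /\
  height g (x :: y :: r) = (height g (p :: q :: r) + (true \notin records g (p :: q :: r)))%N.
Proof.
move=> E x0 /=.
have -> : (g + x == 0)%N = false by lia.
have -> : ((g + x).-1 + y = g + p + q)%N by lia.
have [gp|gp] := eqVneq (g + p)%N 0%N.
  by rewrite gp add0n /= ?inE addn0.
have -> : (g + p + q == 0)%N = false by lia.
have [s1|s1] := eqVneq ((g + p).-1 + q)%N 0%N.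
  by have -> : (g + p + q).-1 = 0%N by [lia]; rewrite s1 /= ?inE addn0.
have -> : (g + p + q).-1 = (((g + p).-1 + q).-1).+1 by lia.
have [-> ->] := records_heightS ((g + p).-1 + q).-1 r.
by rewrite /= ?inE.
Qed.

Lemma profile_exchange e e0 p q x y r p0 q0 x0 y0 r0 :
  size e = size e0 -> profile (e ++ p :: q :: r) = profile (e0 ++ p0 :: q0 :: r0) ->
  (x + y = (p + q).+1)%N -> (x0 + y0 = (p0 + q0).+1)%N -> (0 < x)%N -> (0 < x0)%N ->
  profile (e ++ x :: y :: r) = profile (e0 ++ x0 :: y0 :: r0).
Proof.
move=> sz P S S0 xp xp0.
have := congr1 fst P; rewrite /= !records_cat => /eqP.
rewrite eqseq_cat ?size_records // => /andP[/eqP Ee /eqP Er].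
have := congr1 snd P; rewrite /= !height_cat => Eh.
rewrite /profile !records_cat !height_cat Ee.
have [-> ->] := records_height_exchange (height 0 e) r S xp.
have [-> ->] := records_height_exchange (height 0 e0) r0 S0 xp0.
by rewrite Er Eh.
Qed.

Lemma last_descent c : bounded c ->
  c = nseq (size c) 0%N \/ exists e x m, c = e ++ x.+1 :: 0%N :: nseq m 0%N.
Proof.
elim: c => [|x c IHc] /=; first by left.
case/andP=> lex /IHc[cE|[e [y [m ->]]]]; last by right; exists (x :: e), y, m.
case: x lex => [_|x lt]; first by left; rewrite -cE.
by right; rewrite cE; case: (size c) lt => // m _; exists [::], x, m.
Qed.

(** * Local moves connect the words of a given profile *)

(** Adjacent letters may exchange units as long as the first stays positive;
    these are the moves that Schubert polynomials realize. If the first letter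
    were allowed to vanish, the move could create a new minimum. *)
Inductive linked : seq nat -> seq nat -> Prop :=
| linked_refl c : linked c c
| linked_sym c d : linked c d -> linked d c
| linked_trans c d e : linked c d -> linked d e -> linked c e
| linked_local e k l k' l' r :
    k + l = k' + l' -> 0 < k -> 0 < k' ->
    bounded (e ++ k :: l :: r) -> bounded (e ++ k' :: l' :: r) ->
    linked (e ++ k :: l :: r) (e ++ k' :: l' :: r).

Lemma linked_size c d : linked c d -> size c = size d.
Proof. by elim=> // [c1 d1 e1 _ -> _ ->//|e k l k' l' r *]; rewrite !size_cat. Qed.

Lemma linked_bounded c d : linked c d -> bounded c = bounded d.
Proof. by elim=> // [c1 d1 e1 _ -> _ ->|e k l k' l' r _ _ _ -> ->]. Qed.

Lemma linked_cons x c d : x <= size c -> linked c d -> linked (x :: c) (x :: d).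
Proof.
move=> + Lcd; elim: Lcd => [c1|c1 d1 L IH|c1 d1 e1 L1 IH1 L2 IH2|e k l k' l' r E k0 k0' b b'] lex.
- exact: linked_refl.
- by apply/linked_sym/IH; rewrite (linked_size L).
- apply: linked_trans (IH1 lex) (IH2 _); by rewrite -(linked_size L1).
- rewrite -!(cat_cons x e); apply: linked_local => //=; rewrite ?b ?b' andbT //.
  by move: lex; rewrite !size_cat.
Qed.

Lemma linked_catl e c d : bounded (e ++ c) -> linked c d -> linked (e ++ c) (e ++ d).
Proof.
elim: e => //= x e IHe /andP[lex /IHe IH] /IH.
exact: linked_cons.
Qed.

(** A unit travels to the left through a run of ones: each 1 is raised to 2
    and passes a unit on. *)
Lemma linked_pass r : forall x z s, 0 < x ->
  bounded (x :: nseq r 1 ++ z.+1 :: s) -> bounded (x.+1 :: nseq r 1 ++ z :: s) ->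
  linked (x :: nseq r 1 ++ z.+1 :: s) (x.+1 :: nseq r 1 ++ z :: s).
Proof.
elim: r => [|r IHr] x z s x0 /= b b'.
  by apply: (@linked_local [::]); rewrite //= addSnnS.
have b2 : bounded (2 :: nseq r 1 ++ z :: s).
  move: b b'; rewrite /= !size_cat !size_nseq /=.
  move=> /and3P[_ _ /bounded_catr /= /andP[zs _]] /and3P[_ _ ->]; rewrite andbT; lia.
apply: (@linked_trans _ (x :: 2 :: nseq r 1 ++ z :: s)).
  apply: linked_cons; first by case/andP: b.
  by apply: IHr => //; case/andP: b.
apply: (@linked_local [::]) => //=; first by lia.
by case/andP: b => + _; move: b2 => /= ->; rewrite !size_cat /= => ->.
Qed.

Lemma split_ones_last d : all (leq 1) d -> size d < sumn d ->
  exists e z r, d = e ++ z.+2 :: nseq r 1.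
Proof.
elim/last_ind: d => // d x IHd; rewrite all_rcons sumn_rcons size_rcons => /andP[x0 pd] lt.
case: x x0 lt => // -[_ lt|x _ _]; last by exists d, x, 0; rewrite cats1.
case: IHd => // [|e [z [r ->]]]; first by lia.
exists e, z, r.+1; rewrite rcons_cat /=; congr (_ ++ _ :: _).
by elim: (r) => //= n ->.
Qed.

Lemma split_ones_first d : all (leq 1) d -> size d < sumn d ->
  exists r z e, d = nseq r 1 ++ z.+2 :: e.
Proof.
elim: d => // -[|[|x]] // d IHd /= pd lt; last by exists 0, x, d.
have [|r [z [e ->]]] := IHd pd; first by lia.
by exists r.+1, z, e.
Qed.

(** While the walk stays above its starting minimum, the letters read so far
    have enough units in reserve to fill every 0. Going from left to right, a 0
    takes one unit from the last letter that is at least 2, through the ones in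
    between. *)
Lemma linked_positive d s : true \notin records 0 d -> s != [::] -> bounded (d ++ s) ->
  exists d', [/\ size d' = size d, sumn d' = sumn d, all (leq 1) d'
             & linked (d ++ s) (d' ++ s)].
Proof.
elim/last_ind: d s => [|d x IHd] s; first by exists [::]; split=> //; exact: linked_refl.
rewrite -cats1 records_cat mem_cat negb_or /= inE => /andP[nr hx] s0.
rewrite -catA /= => b.
have [//|d' [sz sm pd L]] := IHd (x :: s) nr _ b.
case: x => [|x] in hx b L *; last first.
  exists (d' ++ [:: x.+1]); rewrite all_cat pd /= -catA /= !sumn_cat !size_cat sz sm.
  by split.
have lt : size d' < sumn d' by move: hx (height_sumn nr); lia.
have [e [z [r dE]]] := split_ones_last pd lt.
exists (e ++ z.+1 :: nseq r 1 ++ [:: 1]); split.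
- by rewrite !size_cat -sz dE size_cat /= !size_cat /= !size_nseq; lia.
- by rewrite !sumn_cat -sm dE sumn_cat /= !sumn_cat /=; lia.
- by move: pd; rewrite dE !all_cat /= !all_cat /= andbT => /andP[-> ->].
have b1 : bounded (d' ++ 0 :: s) by rewrite -(linked_bounded L).
apply: linked_trans L _; rewrite dE -!catA /= -catA /=.
have b1' : bounded (e ++ z.+2 :: nseq r 1 ++ 0 :: s) by move: b1; rewrite dE -catA.
apply: linked_catl => //; apply: linked_sym.
have b2 := bounded_catr b1'.
apply: linked_pass => //; move: b2 => /= /andP[le b3].
have b4 : bounded (nseq r 1 ++ 1 :: s).
  apply: bounded_cat_swap b3 => //=.
  by move: (bounded_catr b) => /= ->; rewrite andbT; case: (s) s0.
by rewrite b4 andbT; move: le; rewrite !size_cat /=; lia.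
Qed.

(** The units missing in the head are taken, one at a time, from the first
    letter that is at least 2. *)
Lemma linked_raise_head k x d s : 0 < x -> all (leq 1) d -> size d + k <= sumn d ->
  bounded (x :: d ++ s) -> x + k <= size d + size s ->
  exists d', [/\ size d' = size d, sumn d' + k = sumn d, all (leq 1) d'
             & linked (x :: d ++ s) ((x + k) :: d' ++ s)].
Proof.
elim: k x d => [|k IHk] x d x0 pd lt b le.
  by exists d; rewrite !addn0; split=> //; exact: linked_refl.
have [|r [z [e dE]]] := split_ones_first pd; first by lia.
have b1 : bounded (x.+1 :: nseq r 1 ++ z.+1 :: e ++ s).
  move: b le; rewrite dE /= -!catA !size_cat /= !size_cat => /andP[_ b] le.
  apply/andP; split; first by lia.
  apply: (bounded_cat_swap _ _ b); first by [].
  by move: (bounded_catr b) => /= /andP[+ ->]; rewrite !size_cat; lia.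
have L : linked (x :: d ++ s) (x.+1 :: (nseq r 1 ++ z.+1 :: e) ++ s).
  by move: b; rewrite dE -!catA /= => b; apply: linked_pass.
have [//|||||d' [sz sm pd' L']] := IHk x.+1 (nseq r 1 ++ z.+1 :: e).
- by move: pd; rewrite dE !all_cat.
- by move: lt; rewrite dE !size_cat !sumn_cat /=; lia.
- by rewrite -catA.
- by move: le; rewrite dE !size_cat /=; lia.
exists d'; split=> //.
- by rewrite sz dE !size_cat.
- by move: sm; rewrite dE !sumn_cat /=; lia.
by rewrite -addSnnS; apply: linked_trans L'.
Qed.

Lemma linked_same_sum d d' s : size d = size d' -> sumn d = sumn d' ->
  all (leq 1) d -> all (leq 1) d' -> bounded (d ++ s) -> bounded (d' ++ s) ->
  linked (d ++ s) (d' ++ s).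
Proof.
move: {2}(size d) (erefl (size d)) => n.
elim: n d d' => [|n IHn] [|x d] [|x' d'] //= => [*|]; first exact: linked_refl.
wlog le : x x' d d' / x <= x' => [W|].
  move=> E1 E2 *; case/orP: (leq_total x x') => le; first exact: W.
  by apply: linked_sym; apply: W => //; rewrite -E2.
move=> [szn] [sz] sm /andP[x0 pd] /andP[x0' pd'] /andP[lx b] /andP[lx' b'].
have lt := sumn_pos pd'.
have [|||d2 [sz2 sm2 pd2 L]] := @linked_raise_head (x' - x) x d s x0 pd.
- lia.
- by rewrite /= lx.
- by move: lx'; rewrite size_cat; lia.
move: L; rewrite subnKC // => L.
have /= := linked_bounded L; rewrite lx b => /esym/andP[lx2 b2].
apply: linked_trans L _.
apply: linked_cons => //; apply: IHn => //; lia.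
Qed.

Lemma bounded_rcons c : bounded c -> c != [::] -> exists d, c = rcons d 0.
Proof.
case/lastP: c => // d x; rewrite -cats1 => /bounded_catr /=.
by rewrite leqn0 => /andP[/eqP -> _] _; exists d; rewrite cats1.
Qed.

(** Blocks between marks are all linked to the word [1 ... 1 0]; after the
    last mark the sum of the letters is determined by the height, and the two
    words are linked through positive words. *)
Theorem linked_profile c d : bounded c -> bounded d -> profile c = profile d -> linked c d.
Proof.
move: {2}(size c).+1 (ltnSn (size c)) => n; elim: n c d => // n IHn c d lt bc bd [Er Eh].
have sz : size c = size d by rewrite -(size_records 0) Er size_records.
have [rec|nrec] := boolP (true \in records 0 c).
  have [e [s [cE rcE hcE nr se]]] := records_split rec.
  have [|e' [s' [dE rdE hdE nr' se']]] := @records_split d; first by rewrite -Er.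
  move: Er; rewrite rcE rdE => /nseq_true_inj[sze Ers].
  have flat e1 s1 : bounded (e1 ++ 0 :: s1) -> true \notin records 0 e1 -> sumn e1 = size e1 ->
      linked (e1 ++ 0 :: s1) (nseq (size e1) 1 ++ 0 :: s1).
    move=> b1 n1 m1; have [//|e2 [sz2 sm2 p2 L2]] := linked_positive n1 _ b1.
    by rewrite -sz2 -all_ones // sm2 sz2.
  rewrite cE in lt bc *; rewrite dE in bd *.
  have L1 := flat _ _ bc nr se; have L2 := flat _ _ bd nr' se'.
  apply: linked_trans L1 _; apply: linked_sym; apply: linked_trans L2 _; rewrite -sze.
  apply: linked_sym; rewrite -!cat_rcons.
  have b1 : bounded (nseq (size e) 1 ++ 0 :: s) by rewrite -(linked_bounded (flat _ _ bc nr se)).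
  apply: linked_catl; first by rewrite cat_rcons.
  apply: IHn.
  - by move: lt; rewrite size_cat /=; lia.
  - by move: (bounded_catr bc).
  - by move: (bounded_catr bd).
  - by rewrite /profile Ers -hcE Eh hdE.
case: c => [|x c] in lt bc Er Eh sz nrec *.
  by case: (d) sz => // _; apply: linked_refl.
have [|c0 cE] := bounded_rcons bc; first by [].
have [|d0 dE] := bounded_rcons bd; first by case: (d) sz.
have nrd : true \notin records 0 d by rewrite -Er.
have := height_sumn nrd; rewrite -Eh -sz (height_sumn nrec) !add0n.
move: nrec nrd; rewrite cE dE -!cats1 !records_cat !mem_cat !negb_or !sumn_cat /= !addn0.
move=> /andP[nrc _] /andP[nrd _] sm.
have [//||c1 [sz1 sm1 p1 L1]] := @linked_positive c0 [:: 0] nrc; first by rewrite cats1 -cE.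
have [//||d1 [sz2 sm2 p2 L2]] := @linked_positive d0 [:: 0] nrd; first by rewrite cats1 -dE.
apply: (linked_trans L1); apply: linked_sym; apply: (linked_trans L2); apply: linked_sym.
apply: linked_same_sum => //.
- by move: sz; rewrite cE dE !size_rcons sz1 sz2 => -[].
- by rewrite sm1 sm2.
- by rewrite -(linked_bounded L1) cats1 -cE.
- by rewrite -(linked_bounded L2) cats1 -dE.
Qed.

(** * The lexicographic order and the greedy words *)

Fixpoint lexle (c d : seq nat) : bool :=
  match c, d with
  | x :: c', y :: d' => (x < y)%N || (x == y) && lexle c' d'
  | _, _ => true
  end.

Lemma lexle_refl c : lexle c c.
Proof. by elim: c => //= x c ->; rewrite eqxx orbT. Qed.

Lemma lexle_anti c d : size c = size d -> lexle c d -> lexle d c -> c = d.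
Proof.
elim: c d => [|x c IHc] [|y d] //= [sz].
case/orP=> [xy|/andP[/eqP-> le]] /orP[yx|/andP[/eqP E le']]; try lia.
by rewrite (IHc d).
Qed.

Lemma lexle_total c d : lexle c d || lexle d c.
Proof.
elim: c d => [|x c IHc] [|y d] //=.
by case: ltngtP => //= _; exact: IHc.
Qed.

Lemma lexle_cat e e' c d : size e' = size e -> lexle (e' ++ c) (e ++ d) ->
  (e' = e /\ lexle c d) \/ (e' != e /\ forall c' d', lexle (e' ++ c') (e ++ d')).
Proof.
elim: e e' => [|x e IHe] [|y e'] //= => [_|[sz]]; first by left.
case/orP=> [lt|/andP[/eqP-> /(IHe _ sz)[[-> le]|[ne H]]]].
- right; split=> [|c' d']; last by rewrite lt.
  by apply/eqP => -[E _]; move: lt; rewrite E ltnn.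
- by left.
by right; split=> [|c' d']; rewrite ?eqxx ?H ?orbT // eqseq_cons eqxx.
Qed.

Lemma lexle_catl e c d : lexle (e ++ c) (e ++ d) = lexle c d.
Proof. by elim: e => //= x e ->; rewrite ltnn eqxx. Qed.

Lemma lexle_nil0 c m : size c = m -> lexle c (nseq m 0%N) -> c = nseq m 0%N.
Proof.
move=> sz le; apply: lexle_anti; rewrite ?size_nseq //.
by rewrite -sz; elim: c {sz le} => //= x c ->; rewrite andbT eq_sym; case: x.
Qed.

Lemma sumn_nseq0 m : sumn (nseq m 0) = 0.
Proof. by rewrite sumn_nseq. Qed.

Lemma sumn_eq0 c : sumn c = 0 -> c = nseq (size c) 0.
Proof. by elim: c => //= x c IHc E; rewrite {1}IHc; [congr (_ :: _)|]; lia. Qed.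

(** Letters at their maximum, then one arbitrary letter, then zeros: the
    lexicographically largest bounded word with its length and sum. *)
Inductive greedy : seq nat -> Prop :=
| greedy_nil : greedy [::]
| greedy_full c : greedy c -> greedy (size c :: c)
| greedy_last k m : greedy (k :: nseq m 0).

(** The words of the permutations in [Aminus]. *)
Inductive minus_word : seq nat -> Prop :=
| minus_greedy c : greedy c -> minus_word c
| minus_block k c : minus_word c -> minus_word (k :: nseq k 0 ++ c).

Lemma greedy_lexmax c d : greedy c -> bounded d -> size d = size c -> sumn d = sumn c ->
  lexle c d -> d = c.
Proof.
move=> G; elim: G d => [[]//|{}c _ IHc [|x d] //= /andP[lx b] [sz] sm|k m [|x d] //= _ [sz]].
  case/orP=> [|/andP[/eqP E le]]; first by lia.
  by rewrite -E (IHc d) //; lia.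
rewrite sumn_nseq0 => sm /orP[|/andP[/eqP E _]]; first by lia.
have d0 : sumn d = 0 by lia.
by rewrite (sumn_eq0 d0) sz size_nseq E.
Qed.

Lemma minus_block_cat k c : k :: nseq k 0 ++ c = (if k is k'.+1 then k :: nseq k' 0 else [::]) ++ 0 :: c.
Proof.
by case: k => //= k; congr (_ :: _); elim: k => //= k <-.
Qed.

Lemma profile_minus_block k c :
  profile (k :: nseq k 0 ++ c) = (nseq k false ++ true :: records 0 c, height 0 c).
Proof.
rewrite minus_block_cat profile_block; first by case: k => //= k; rewrite size_nseq.
  by case: k => //= k; rewrite inE /=; apply: records_zeros.
by case: k => //= k; rewrite sumn_nseq0 size_nseq addn0.
Qed.

(** In a block that ends with a mark, the letters sum to the length minus
    one, so no word with the same profile starts with more than [k 0 ... 0]. *)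
Lemma minus_lexmax c d : minus_word c -> bounded d -> size d = size c ->
  profile d = profile c -> lexle c d -> d = c.
Proof.
move=> M; elim: M d => [{}c G d bd sz P|k {}c M IH d bd sz P le].
  by apply: greedy_lexmax => //; apply: profile_eq_sumn.
rewrite profile_minus_block in P.
have [|e [s [dE rE hE nr se]]] := @records_split d.
  by case: P => -> _; rewrite mem_cat inE eqxx orbT.
case: P; rewrite rE hE => /nseq_true_inj[szk Ers] Ehs.
move: le bd sz; rewrite dE minus_block_cat => le bd sz.
suff eE : e = (if k is k'.+1 then k :: nseq k' 0 else [::]).
  move: le sz; rewrite eE lexle_catl /= !size_cat /= => le sz.
  have {sz}sz : size s = size c by lia.
  by rewrite (IH s) //; [move: bd => /bounded_catr|rewrite /profile Ers Ehs].
case: k szk le {IH M sz dE rE} => [|k] szk le; first by case: (e) szk.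
case: e szk se le {nr bd} => [|x e] //= [szk] se /orP[|/andP[/eqP E _]]; first by lia.
have e0 : sumn e = 0 by lia.
by rewrite (sumn_eq0 e0) szk E.
Qed.

Lemma minus_unique c d : minus_word c -> minus_word d -> bounded c -> bounded d ->
  size c = size d -> profile c = profile d -> c = d.
Proof.
move=> Mc Md bc bd sz P; case/orP: (lexle_total c d) => le.
  by rewrite (minus_lexmax Mc bd).
by apply: (minus_lexmax Md).
Qed.

Lemma greedy_exists n s : s <= 'C(n, 2) ->
  exists c, [/\ greedy c, bounded c, size c = n & sumn c = s].
Proof.
elim: n s => [|n IHn] s; first by case: s => // _; exists [::]; split=> //; exact: greedy_nil.
rewrite binS bin1 => le.
have [sn|ns] := leqP s n.
  exists (s :: nseq n 0); split; rewrite /= ?size_nseq ?sumn_nseq0 ?addn0 //.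
    exact: greedy_last.
  by rewrite sn -[nseq _ _]cats0; exact: bounded_zeros.
have [|c [G b szc E]] := IHn (s - n); first by lia.
by exists (size c :: c); split=> /=; [exact: greedy_full|rewrite leqnn|rewrite szc|lia].
Qed.

(** A greedy word has its units in front, so the walk goes below its starting
    height only if the sum of the letters forces it. *)
Lemma greedy_records g c : greedy c -> size c <= g + sumn c -> true \notin records g c.
Proof.
move=> G; elim: G g => [//|{}c _ IHc g|k m g] /= le; rewrite inE negb_or.
  have gc : 0 < g + size c by case: (c) le => /= *; lia.
  rewrite IHc ?andbT; last by lia.
  by case: (g + size c) gc.
rewrite size_nseq sumn_nseq0 in le; rewrite records_zeros ?andbT; last by lia.
by have -> : (g + k == 0) = false by lia.
Qed.

(** * The flat words *)

(** The code of a permutation has this property when the permutation avoids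
    132, that is when its Lehmer code is weakly decreasing. The default value
    of [head] makes the condition void at the last letter. *)
Fixpoint no_big_drop (c : seq nat) : bool :=
  if c is x :: c' then (x <= (head x c').+1)%N && no_big_drop c' else true.

Lemma no_big_drop_catr e c : no_big_drop (e ++ c) -> no_big_drop c.
Proof. by elim: e => //= x e IHe /andP[_ /IHe]. Qed.

(** At the first descent, lowering the larger letter keeps all drops small. *)
Lemma no_big_drop_lower e y r : no_big_drop (e ++ y.+1 :: y :: r) -> sorted leq (rcons e y.+1) ->
  no_big_drop (e ++ y :: y :: r).
Proof.
elim: e => [|x e IHe] /=; first by rewrite leqnSn => /andP[_ ->].
move=> /andP[lx nb] so; rewrite IHe ?andbT //; last by case: (e) so => //= ? ? /andP[].
by case: e so lx {IHe nb} => //= so _; rewrite andbT in so.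
Qed.

Lemma first_descent c : ~~ sorted leq c ->
  exists e x y r, [/\ c = e ++ x :: y :: r, (y < x)%N & sorted leq (rcons e x)].
Proof.
elim: c => // x [|y c] // IHc.
rewrite [sorted _ _]/= negb_and -ltnNge; have [yx _|xy /=] := ltnP y x.
  by exists [::], x, y, c.
case/IHc=> [[|z e] [a [b [r [[E0 cE] ab so]]]]]; subst y.
  by exists [:: x], a, b, r; rewrite cE /= xy.
by exists (x :: z :: e), a, b, r; rewrite cE /= xy.
Qed.

(** Among the words with given length and sum and no drop larger than one,
    this one has letters as equal as possible, with the final staircase imposed
    by boundedness. *)
Definition flat k p q := nseq p.+1 k.+1 ++ nseq q.+1 k ++ rev (iota 0 k).

(** The words of the permutations in [Aplus]. *)
Inductive plus_word : seq nat -> Prop :=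
| plus_nil : plus_word [::]
| plus_block k c : plus_word c -> plus_word (nseq k 1 ++ 0 :: c)
| plus_flat k p q : 0 < k -> plus_word (flat k p q).

Lemma rev_iotaS k : rev (iota 0 k.+1) = k :: rev (iota 0 k).
Proof. by rewrite -{1}addn1 iotaD rev_cat. Qed.

Lemma no_big_drop_nseq m x c : no_big_drop c -> x <= (head x c).+1 -> no_big_drop (nseq m x ++ c).
Proof.
move=> nb le; elim: m => //= m ->; rewrite andbT.
by case: m => [|m] /=; first by []; apply: leqnSn.
Qed.

Lemma no_big_drop_stairs k : no_big_drop (rev (iota 0 k)).
Proof. by elim: k => // k IHk; rewrite rev_iotaS /= IHk andbT; case: (k) => // m; rewrite rev_iotaS. Qed.

Lemma plus_no_big_drop c : plus_word c -> no_big_drop c.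
Proof.
elim=> [//|k {}c _ nb|k p q k0]; first exact: no_big_drop_nseq.
apply: no_big_drop_nseq; last by [].
by apply: no_big_drop_nseq; [exact: no_big_drop_stairs | case: (k) => // m; rewrite rev_iotaS].
Qed.

Lemma profile_plus_block k c :
  profile (nseq k 1 ++ 0 :: c) = (nseq k false ++ true :: records 0 c, height 0 c).
Proof.
rewrite profile_block ?size_nseq ?sumn_nseq ?mul1n //.
by apply: records_positive; rewrite all_nseq orbT.
Qed.

Lemma bounded_stairs k : bounded (rev (iota 0 k)).
Proof. by elim: k => // k IHk; rewrite rev_iotaS /= IHk size_rev size_iota leqnn. Qed.

Lemma bounded_nseq m x c : bounded c -> x <= size c -> bounded (nseq m x ++ c).
Proof.
move=> bc le; elim: m => //= m ->; rewrite andbT size_cat.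
exact: leq_trans le (leq_addl _ _).
Qed.

Lemma bounded_flat k p q : bounded (flat k p q).
Proof.
apply: bounded_nseq; last by rewrite size_cat size_nseq size_rev size_iota; lia.
by apply: bounded_nseq; [exact: bounded_stairs | rewrite size_rev size_iota].
Qed.

Lemma records_nseq g m x c : true \notin records (g + m * x) c -> true \notin records g (nseq m x.+1 ++ c).
Proof.
elim: m g => [|m IHm] g; first by rewrite addn0.
rewrite mulSn addnA => H; rewrite /= addnS inE /=; exact: IHm.
Qed.

Lemma records_stairs g k : 0 < g -> true \notin records g (rev (iota 0 k)).
Proof.
elim: k g => // k IHk [|g] // _; rewrite rev_iotaS /= addSn inE /=.
by case: k IHk => [|k] IHk //; apply: IHk; rewrite addnS.
Qed.

Lemma records_flat k p q : 0 < k -> true \notin records 0 (flat k p q).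
Proof.
case: k => // k _; apply: records_nseq; apply: records_nseq; apply: records_stairs.
by rewrite addn_gt0 muln_gt0.
Qed.

Lemma size_flat k p q : size (flat k p q) = p + q + k + 2.
Proof. by rewrite !size_cat !size_nseq size_rev size_iota; lia. Qed.

Lemma sumn_flat k p q : sumn (flat k p q) = p.+1 * k.+1 + q.+1 * k + 'C(k, 2).
Proof.
rewrite !sumn_cat !sumn_nseq sumn_rev addnA (mulnC k.+1) (mulnC k); congr (_ + _ + _).
by elim: k => // k IHk; rewrite -sumn_rev rev_iotaS /= sumn_rev IHk binS bin1 addnC.
Qed.

(** The sum of the flat word of length [n] with letters [k], before the first
    of its letters is raised to [k + 1]. *)
Definition base n k := k * (n - k) + 'C(k, 2).

Lemma baseS n k : k < n -> base n k.+1 = base n k + (n - k.+1).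
Proof.
move=> lt; rewrite /base binS bin1; have -> : n - k = (n - k.+1).+1 by lia.
by rewrite mulnS mulSn; lia.
Qed.

Lemma base_mono n k l : k <= l <= n -> base n k <= base n l.
Proof.
elim: l => [|l IHl]; first by rewrite leqn0 => /andP[/eqP->].
rewrite leq_eqVlt => /andP[/orP[/eqP->//|lt] ln].
by rewrite baseS //; apply: leq_trans (IHl _) (leq_addr _ _); lia.
Qed.

(** For a fixed length, the sums with letters [k] and [k + 1] form the
    interval from [base n k + 1] to [base n (k + 1)]; consecutive intervals are
    adjacent. This gives uniqueness and existence of a flat word with given sum. *)
Lemma sumn_flat_base k p q : sumn (flat k p q) = base (size (flat k p q)) k + p.+1.
Proof.
rewrite sumn_flat size_flat /base; have -> : p + q + k + 2 - k = p.+1 + q.+1 by lia.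
by rewrite mulnDr !mulnS !mulSn; lia.
Qed.

(** The sum determines [k], as the intervals of [sumn_flat_base] are
    disjoint, and then the position inside the interval. *)
Lemma flat_inj k p q k' p' q' : size (flat k p q) = size (flat k' p' q') ->
  sumn (flat k p q) = sumn (flat k' p' q') -> flat k p q = flat k' p' q'.
Proof.
wlog le : k p q k' p' q' / k <= k' => [W|] sz sm.
  by case/orP: (leq_total k k') => le; [apply: W|apply/esym/W].
move: sm; rewrite !sumn_flat_base sz; move: sz; rewrite !size_flat => sz.
move: le; rewrite leq_eqVlt => /orP[/eqP E|lt sm].
  by subst k' => /addnI[pp]; subst p'; congr flat; lia.
have := @base_mono (p' + q' + k' + 2) k.+1 k'; have := @baseS (p' + q' + k' + 2) k; lia.
Qed.

(** The intervals of [sumn_flat_base] cover all the sums from [n] on. *)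
Lemma flat_exists n s : n <= s <= 'C(n, 2) -> 0 < n ->
  exists k p q, [/\ 0 < k, size (flat k p q) = n & sumn (flat k p q) = s].
Proof.
move=> /andP[ns sC] n0.
have n3 : 2 < n.
  case: n n0 ns sC => [|[|[|n]]] // _ ns sC; last by rewrite binn in sC; lia.
  by rewrite bin_small // in sC; lia.
(* [k] is the index of the interval that contains [s] *)
have [k [k0 kn lo hi]] : exists k, [/\ 0 < k, k.+2 <= n, base n k < s & s <= base n k.+1].
  have top : s <= base n (n - 2).+1.
    have -> : (n - 2).+1 = n.-1 by lia.
    have E1 : n - n.-1 = 1 by lia.
    by move: sC; rewrite /base E1 muln1 -[in 'C(n, 2)](prednK n0) binS bin1 addnC.
  elim: {-2}(n - 2) (leqnn (n - 2)) top => [|j IHj] jn top.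
    by move: top; rewrite /base mul1n (@bin_small 1 2) //; lia.
  have [lo|hi] := ltnP (base n j.+1) s; first by exists j.+1; split=> //; lia.
  by apply: IHj => //; lia.
rewrite baseS in hi; last by lia.
have szf : size (flat k (s - base n k).-1 (n - k - 2 - (s - base n k).-1)) = n.
  by rewrite size_flat; lia.
exists k, (s - base n k).-1, (n - k - 2 - (s - base n k).-1); split=> //.
by rewrite sumn_flat_base szf; lia.
Qed.

Lemma plus_unique c d : plus_word c -> plus_word d -> size c = size d -> profile c = profile d -> c = d.
Proof.
move=> Pc; elim: Pc d => [d _|k {}c Pc IHc d|k p q k0 d]; first by case: d.
- case=> [|l {}d Pd|l p q l0]; rewrite ?profile_plus_block; first by rewrite size_cat addnS.
    move=> sz [/nseq_true_inj[E Er] Eh]; rewrite E (IHc d) // /profile ?Er ?Eh //.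
    by move: sz; rewrite !size_cat !size_nseq /=; lia.
  move=> _ /(congr1 fst) Er; have := records_flat p q l0.
  by rewrite -[records _ _]Er mem_cat inE eqxx orbT.
case=> [|l {}d Pd|l p' q' l0]; rewrite ?profile_plus_block //.
  move=> _ /(congr1 fst) Er; have := records_flat p q k0.
  by rewrite [records _ _]Er mem_cat inE eqxx orbT.
by move=> sz /(profile_eq_sumn sz) sm; exact: flat_inj.
Qed.

(** * Counting the profiles *)

(** The profiles with at least one mark. The first letter either carries a
    mark and any profile follows, or it prolongs the first block of a profile
    that already has a mark. *)
Fixpoint closed_profiles n : seq (bitseq * nat) :=
  if n is m.+1 then
    [seq (true :: p.1, p.2) | p <- closed_profiles m ++ [seq (nseq m false, g) | g <- iota 0 ('C(m, 2).+1 - m)]]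
    ++ [seq (false :: p.1, p.2) | p <- closed_profiles m]
  else [::].

(** The profiles without marks: the final height is the sum of the letters
    minus their number, and a bounded word has sum at most ['C(n, 2)]. The
    interval is empty for lengths 1 and 2. *)
Definition open_profiles n : seq (bitseq * nat) :=
  [seq (nseq n false, g) | g <- iota 0 ('C(n, 2).+1 - n)].

Definition profiles n := closed_profiles n ++ open_profiles n.

Lemma closed_profilesS n : closed_profiles n.+1 =
  [seq (true :: p.1, p.2) | p <- profiles n] ++ [seq (false :: p.1, p.2) | p <- closed_profiles n].
Proof. by []. Qed.

Lemma leq_bin2 n : n <= 'C(n, 2).+1.
Proof. by elim: n => [|[|n] IHn] //; rewrite binS bin1; lia. Qed.

Lemma size_closed_profiles n : size (closed_profiles n) + 'C(n, 2) + 1 = 2 ^ n.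
Proof.
elim: n => // n IHn; rewrite closed_profilesS size_cat !size_map size_cat size_map size_iota.
have := leq_bin2 n; rewrite binS bin1 expnS -IHn.
move: (size (closed_profiles n)) => a; lia.
Qed.

Lemma size_profiles n : size (profiles n) = 2 ^ n - n.
Proof.
rewrite size_cat size_map size_iota -size_closed_profiles; have := leq_bin2 n.
move: (size (closed_profiles n)) => a; lia.
Qed.

Lemma closed_profiles_true n b g : (b, g) \in closed_profiles n -> true \in b.
Proof.
elim: n b g => // n IHn b g; rewrite closed_profilesS mem_cat => /orP[/mapP[p _ [-> _]]|/mapP[[b' g'] /IHn H [-> _]]].
  by rewrite inE eqxx.
by rewrite inE H orbT.
Qed.

Lemma uniq_profiles n : uniq (profiles n).
Proof.
have uo m : uniq (closed_profiles m) -> uniq (profiles m).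
  move=> uc; rewrite cat_uniq uc /= map_inj_uniq ?iota_uniq ?andbT => [|g g' [] //].
  apply/hasPn => -[b g] /mapP[g' _ [-> _]]; apply/negP => /closed_profiles_true.
  by rewrite mem_nseq andbF.
suff uc : uniq (closed_profiles n) by exact: uo.
elim: n => // n IHn; rewrite closed_profilesS cat_uniq.
rewrite !map_inj_uniq ?IHn ?uo // => [|[b g] [b' g'] [-> ->] //|[b g] [b' g'] [-> ->] //].
by rewrite andbT; apply/hasPn => -[b g] /mapP[p _ [-> _]]; apply/mapP => -[q _ []].
Qed.

(** Splitting off the first block, which may have any length. *)
Lemma closed_profilesP n b g : (b, g) \in closed_profiles n <->
  exists t m b', [/\ n = (t + m).+1, b = nseq t false ++ true :: b' & (b', g) \in profiles m].
Proof.
split.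
  elim: n b => // n IHn b; rewrite closed_profilesS mem_cat => /orP[/mapP[[b' g'] H [-> ->]]|/mapP[[b' g'] + [-> E]]].
    by exists 0, n, b'.
  by rewrite -E => /IHn[t [m [b1 [-> -> H]]]]; exists t.+1, m, b1.
case=> t [m [b' [-> -> H]]]; elim: t => [|t IHt]; rewrite closed_profilesS mem_cat.
  by apply/orP; left; apply/mapP; exists (b', g).
by apply/orP; right; apply/mapP; exists (nseq t false ++ true :: b', g).
Qed.

Lemma profile_in_profiles c : bounded c -> profile c \in profiles (size c).
Proof.
move: {2}(size c).+1 (ltnSn (size c)) => N; elim: N c => // N IHN c lt b.
have [rec|nrec] := boolP (true \in records 0 c).
  have [e [s [cE rE hE nr se]]] := records_split rec.
  rewrite mem_cat; apply/orP; left; rewrite /profile rE hE; apply/closed_profilesP.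
  exists (size e), (size s), (records 0 s); rewrite cE size_cat /= addnS; split=> //.
  apply: IHN; first by move: lt; rewrite cE size_cat /=; lia.
  by move: b; rewrite cE => /bounded_catr.
rewrite mem_cat; apply/orP; right; apply/mapP; exists (height 0 c).
  rewrite mem_iota; have := height_sumn nrec; have := sumn_bounded b; lia.
by rewrite /profile {1}(nseq_false nrec) size_records.
Qed.

(** A block with a mark is realized by [k 0 ... 0] and by [1 ... 1 0], an
    unmarked end by a greedy and by a flat word. *)
Lemma profiles_realized n p : p \in profiles n ->
  exists c d, [/\ minus_word c, plus_word d, bounded c /\ bounded d, size c = n /\ size d = n
                & profile c = p /\ profile d = p].
Proof.
move: {2}n.+1 (ltnSn n) p => N; elim: N n => // N IHN n lt [b g].
rewrite mem_cat => /orP[/closed_profilesP[t [m [b' [nE -> H]]]]|/mapP[h + [-> ->]]].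
  have [|c [d [Mc Pd [bc bd] [sc sd] [pc pd]]]] := IHN m _ _ H; first by lia.
  exists (t :: nseq t 0 ++ c), (nseq t 1 ++ 0 :: d); split.
  - exact: minus_block.
  - exact: plus_block.
  - split; first by rewrite /= bounded_zeros // size_cat size_nseq leq_addr.
    by elim: (t) => //= k ->; rewrite size_cat /= addnS.
  - by rewrite /= !size_cat !size_nseq /= sc sd nE; lia.
  by rewrite profile_minus_block profile_plus_block; case: pc => -> ->; case: pd => -> ->.
rewrite mem_iota => hlt.
have sC : n + h <= 'C(n, 2) by lia.
have [c [G bc sc sm]] := greedy_exists sC.
have nrc : true \notin records 0 c by apply: greedy_records => //; lia.
have [d [Pd bd sd smd nrd]] : exists d, [/\ plus_word d, bounded d, size d = n, sumn d = n + h & true \notin records 0 d].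
  case: n {IHN lt hlt sc nrc} sC sm => [|n] sC sm; first by exists [::]; split=> //; [exact: plus_nil|case: (h) sC].
  have [||k [p [q [k0 sz se]]]] := @flat_exists n.+1 (n.+1 + h); [by rewrite leq_addr|by []|].
  exists (flat k p q); split=> //; [exact: plus_flat| |exact: records_flat].
  exact: bounded_flat.
have prof e : true \notin records 0 e -> size e = n -> sumn e = n + h -> profile e = (nseq n false, h).
  move=> nre sze sme; have := height_sumn nre; rewrite sze sme => E.
  by rewrite /profile (nseq_false nre) size_records sze; congr (_, _); lia.
by exists c, d; split=> //; [exact: minus_greedy|rewrite !prof].
Qed.

(** * Codes of lists *)

(** The word of a list; only the relative order of its entries matters. *)
Fixpoint code (s : seq nat) : seq nat :=
  if s is x :: s' then count (ltn x) s' :: code s' else [::].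

Lemma size_code s : size (code s) = size s.
Proof. by elim: s => //= x s ->. Qed.

Lemma bounded_code s : bounded (code s).
Proof. by elim: s => //= x s ->; rewrite size_code count_size. Qed.

Lemma nth_code s i : (i < size s)%N -> nth 0%N (code s) i = count (ltn (nth 0%N s i)) (drop i.+1 s).
Proof. by elim: s i => // x s IHs [|i] /=; rewrite ?drop0 // => /IHs. Qed.

Lemma code_drop k s : code (drop k s) = drop k (code s).
Proof. by elim: k s => [|k IHk] [|x s] //=; rewrite ?drop0 // IHk. Qed.

Lemma perm_count_code e s t : perm_eq s t ->
  exists e', size e' = size e /\ code (e ++ s) = e' ++ code s /\ code (e ++ t) = e' ++ code t.
Proof.
move=> st; elim: e => [|x e [e' [sz [E1 E2]]]]; first by exists [::].
exists (count (ltn x) (e ++ s) :: e'); rewrite /= sz E1 E2; split=> //; split=> //.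
by congr (_ :: _); rewrite !count_cat (seq.permP st).
Qed.

Lemma code_swap e x y r : (x < y)%N ->
  exists e' p q r', [/\ size e' = size e, (p <= q)%N,
    code (e ++ x :: y :: r) = e' ++ q.+1 :: p :: r' & code (e ++ y :: x :: r) = e' ++ p :: q :: r'].
Proof.
move=> xy; have pe : perm_eq (x :: y :: r) (y :: x :: r).
  by rewrite -(cat1s x) -(cat1s y) perm_catCA.
have [e' [sz [E1 E2]]] := perm_count_code e pe.
exists e', (count (ltn y) r), (count (ltn x) r), (code r); split=> //.
- by apply: sub_count => z /=; lia.
- by rewrite E1 /= xy.
by rewrite E2 /= ltnNge (ltnW xy).
Qed.

(** The first letter counts the larger entries, so it determines the first
    entry within the set of all entries. *)
Lemma code_inj s t : perm_eq s t -> uniq s -> code s = code t -> s = t.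
Proof.
have less x y (s1 t1 : seq nat) : perm_eq (x :: s1) (y :: t1) -> (x < y)%N ->
    (count (ltn y) t1 < count (ltn x) s1)%N.
  move=> st xy; have ys : y \in s1.
    have : y \in x :: s1 by rewrite (perm_mem st) mem_head.
    by rewrite inE => /orP[/eqP E|//]; move: xy; rewrite E ltnn.
  have := seq.permP st (ltn y); rewrite /= ltnn (ltnNge y x) (ltnW xy) !add0n => <-.
  move: ys; rewrite -has_pred1 has_count => ys.
  have -> : count (ltn x) s1 = (count (ltn y) s1 + count (fun z => x < z <= y)%N s1)%N.
    rewrite -count_predUI -[LHS]addn0; congr (_ + _)%N; first by apply: eq_count => z /=; lia.
    by apply/esym/eqP; rewrite -leqn0 leqNgt -has_count; apply/hasPn => z _ /=; lia.
  rewrite -[X in (X < _)%N]addn0 ltn_add2l; apply: leq_trans ys _.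
  by apply: sub_count => z /eqP -> /=; lia.
elim: s t => [|x s IHs] t; first by rewrite perm_sym => /perm_nilP ->.
case: t => [|y t]; first by move=> /perm_nilP.
move=> st /andP[_ us] [E1 E2].
have [lt|lt|E] := ltngtP x y; last first.
- by move: st; rewrite E perm_cons => st; rewrite (IHs t).
- by rewrite perm_sym in st; have := less _ _ _ _ st lt; rewrite E1 ltnn.
by have := less _ _ _ _ st lt; rewrite E1 ltnn.
Qed.

Lemma code_mono (f : nat -> nat) s : {mono f : x y / (x < y)%N} -> code (map f s) = code s.
Proof.
move=> fm; elim: s => //= x s ->; congr (_ :: _).
by rewrite count_map; apply: eq_count => y /=; rewrite fm.
Qed.

(** The first letter prescribes the rank of the new first entry; the entries of
    the list already built make room for it by [bump]. *)
Lemma code_surj c : bounded c -> exists s, perm_eq s (iota 0 (size c)) /\ code s = c.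
Proof.
elim: c => [|x c IHc] /=; first by exists [::].
case/andP=> lx /IHc[s [sp cE]].
have szs : size s = size c by rewrite (perm_size sp) size_iota.
rewrite -szs in sp lx *.
exists ((size s - x)%N :: map (bump (size s - x)) s); split.
  apply: uniq_perm.
  - rewrite /= map_inj_uniq; last exact: can_inj (@bumpK _).
    rewrite (perm_uniq sp) iota_uniq andbT.
    by apply/mapP => -[z _]; rewrite /bump; lia.
  - exact: (iota_uniq 0 (size s).+1).
  move=> z; rewrite -[0%N :: _]/(iota 0 (size s).+1) mem_iota add0n inE.
  apply/orP/idP => [[/eqP -> /=|/mapP[y yin ->]]|lz]; first by lia.
    by move: yin; rewrite (perm_mem sp) mem_iota /bump; lia.
  have [E|ne] := eqVneq z (size s - x)%N; [by left|right].
  apply/mapP; exists (unbump (size s - x) z); last by rewrite unbumpKcond (negbTE ne).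
  by rewrite (perm_mem sp) mem_iota /unbump; lia.
rewrite /= code_mono => [|a b]; last by rewrite /bump; lia.
rewrite cE; congr (_ :: _); rewrite count_map (seq.permP sp).
rewrite (@eq_count _ _ (leq (size s - x))) => [|a]; last by rewrite /= /bump; lia.
have {2}-> : size s = ((size s - x) + x)%N by lia.
rewrite iotaD count_cat add0n; set h := (size s - x)%N.
have -> : count (leq h) (iota 0 h) = 0%N.
  by apply/eqP; rewrite -leqn0 leqNgt -has_count; apply/hasPn => z; rewrite mem_iota; lia.
by rewrite -[RHS](size_iota h x); apply/eqP; rewrite -all_count; apply/allP => z; rewrite mem_iota; lia.
Qed.

(** * Lists that avoid 213, 2341 and 1423 *)

Definition avoids3 (P : nat -> nat -> nat -> bool) (s : seq nat) :=
  forall a b c, subseq [:: a; b; c] s -> ~ P a b c.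

Definition avoids4 (P : nat -> nat -> nat -> nat -> bool) (s : seq nat) :=
  forall a b c d, subseq [:: a; b; c; d] s -> ~ P a b c d.

Definition avoids132 := avoids3 (fun a b c => a < c < b).

Definition avoids213 := avoids3 (fun a b c => b < a < c).

Definition avoids312 := avoids3 (fun a b c => b < c < a).

Definition avoids2341 := avoids4 (fun a b c d => [&& d < a, a < b & b < c]).

Definition avoids3124 := avoids4 (fun a b c d => [&& b < c, c < a & a < d]).

Definition avoids1423 := avoids4 (fun a b c d => [&& a < c, c < d & d < b]).

Definition minus_avoiding s := [/\ avoids213 s, avoids2341 s & avoids1423 s].

Definition plus_avoiding s := [/\ avoids132 s, avoids2341 s & avoids3124 s].

Lemma avoids3_sub P s t : subseq s t -> avoids3 P t -> avoids3 P s.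
Proof. by move=> st A a b c H; apply: A; apply: subseq_trans H st. Qed.

Lemma avoids4_sub P s t : subseq s t -> avoids4 P t -> avoids4 P s.
Proof. by move=> st A a b c d H; apply: A; apply: subseq_trans H st. Qed.

Definition decreasing (s : seq nat) := forall b c, subseq [:: b; c] s -> ~ b < c.

Definition increasing (s : seq nat) := forall b c, subseq [:: b; c] s -> b < c.

Lemma subseq_consP a (t : seq nat) x s :
  subseq (a :: t) (x :: s) -> (a = x /\ subseq t s) \/ subseq (a :: t) s.
Proof. by rewrite /=; case: eqP => [->|_] H; [left|right]. Qed.

Lemma subseq_catP (t u v : seq nat) : subseq t (u ++ v) ->
  exists m, subseq (take m t) u /\ subseq (drop m t) v.
Proof.
elim: u t => [|x u IHu] t; first by exists 0; rewrite take0 drop0.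
case: t => [|a t]; first by exists 0; rewrite !sub0seq.
rewrite cat_cons => /subseq_consP[[-> /IHu]|/IHu] [m [s1 s2]].
  by exists m.+1; rewrite /= eqxx.
by exists m; split=> //; apply: subseq_trans s1 (subseq_cons _ _).
Qed.

Lemma subseq_cat2 (b c : nat) u v : b \in u -> c \in v -> subseq [:: b; c] (u ++ v).
Proof. by rewrite -!sub1seq => bu cv; rewrite -[[:: b; c]]/([:: b] ++ [:: c]) cat_subseq. Qed.

Lemma subseq_prefix (t u v : seq nat) : subseq t u -> subseq t (u ++ v).
Proof. by move=> H; apply: subseq_trans H (prefix_subseq _ _). Qed.

Lemma subseq_suffix (t u v : seq nat) : subseq t v -> subseq t (u ++ v).
Proof. by move=> H; apply: subseq_trans H (suffix_subseq _ _). Qed.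

Lemma decreasing_cons x s : decreasing (x :: s) <-> (count (ltn x) s = 0 /\ decreasing s).
Proof.
split=> [D|[/eqP c0 D] b c /subseq_consP[[-> cs] xc|]]; last exact: D.
  split=> [|b c bc]; last by apply: D; apply: subseq_trans bc (subseq_cons _ _).
  apply/eqP; rewrite -leqn0 leqNgt -has_count; apply/hasPn => c cs.
  by apply/negP; apply: D; rewrite /= eqxx sub1seq.
move: c0; rewrite -leqn0 leqNgt -has_count => /hasPn/(_ c).
by rewrite -sub1seq => /(_ cs) /=; rewrite xc.
Qed.

Lemma code_cat_decreasing s t m : decreasing s -> (forall x, x \in s -> count (ltn x) t = m) ->
  code (s ++ t) = nseq (size s) m ++ code t.
Proof.
elim: s => //= x s IHs /decreasing_cons[c0 D] H.
rewrite count_cat c0 (H x) ?mem_head // IHs // => y ys.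
by apply: H; rewrite inE ys orbT.
Qed.

Lemma code_decreasing s : decreasing s -> code s = nseq (size s) 0.
Proof. by move=> D; rewrite -[in code s](cats0 s) (@code_cat_decreasing _ _ 0) // cats0. Qed.

Lemma decreasing_code s m : code s = nseq m 0 -> decreasing s.
Proof.
elim: s m => [|x s IHs] m; first by move=> _ b c.
by case: m => //= m [c0 /IHs D]; apply/decreasing_cons.
Qed.

Lemma code_cat_above u v : (forall x y, x \in u -> y \in v -> y < x) ->
  code (u ++ v) = code u ++ code v.
Proof.
elim: u => //= x u IHu H; rewrite IHu => [|a b au]; last by apply: H; rewrite inE au orbT.
congr (_ :: _); rewrite count_cat -[RHS]addn0; congr (_ + _).
apply/eqP; rewrite -leqn0 leqNgt -has_count; apply/hasPn => y yv /=.
by have := H x y (mem_head _ _) yv; lia.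
Qed.

Lemma split_by (P : pred nat) s : (forall b c, subseq [:: b; c] s -> ~~ P b -> ~~ P c) ->
  s = filter P s ++ filter (predC P) s.
Proof.
elim: s => //= x s IHs H; case: ifP => Px.
  by rewrite /= -IHs // => b c bc; apply: H; apply: subseq_trans bc (subseq_cons _ _).
have nP : {in s, forall y, ~~ P y}.
  by move=> y ys; apply: (H x y); rewrite ?Px // eqxx sub1seq.
have -> : filter P s = [::].
  by apply/eqP; rewrite -(negbK (_ == _)) -has_filter; apply/hasPn.
by congr (_ :: _); apply/esym/all_filterP/allP.
Qed.

Lemma count0P x (s : seq nat) : count (ltn x) s = 0 -> forall y, y \in s -> y <= x.
Proof.
move/eqP; rewrite -leqn0 leqNgt -has_count => /hasPn H y /H /=.
by rewrite -leqNgt.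
Qed.

(** Avoiding 213 from the entry [x] on: all larger entries precede all
    smaller ones. *)
Lemma split_above x s : uniq (x :: s) ->
  (forall b c, subseq [:: b; c] s -> ~ b < x < c) ->
  exists u l, [/\ s = u ++ l, {in u, forall y, x < y}, {in l, forall y, y < x} &
                  count (ltn x) s = size u].
Proof.
move=> /= /andP[xs us] H; exists (filter (ltn x) s), (filter (predC (ltn x)) s); split.
- apply: split_by => b c bc; rewrite -!leqNgt => bx.
  have : b != x by apply/eqP => E; move: xs; rewrite -E (mem_subseq bc) // mem_head.
  by have := H b c bc; lia.
- by move=> y; rewrite mem_filter => /andP[].
- move=> y; rewrite mem_filter /= -leqNgt => /andP[yx ys].
  by have : y != x by [apply/eqP => E; move: xs; rewrite -E ys]; lia.
by rewrite size_filter.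
Qed.

(** If all other entries exceed the first, its letter is maximal. Otherwise,
    as 2341 and 312 are avoided, the larger entries decrease and so do the
    smaller ones, and all the other letters vanish. *)
Lemma avoiding_greedy s : uniq s -> avoids213 s -> avoids312 s -> avoids2341 s -> greedy (code s).
Proof.
elim: s => [_ _ _ _|x s IHs us A B C]; first exact: greedy_nil.
have sub : subseq s (x :: s) by apply: subseq_cons.
have Ax b c : subseq [:: b; c] s -> ~ b < x < c.
  by move=> bc; apply: (A x b c); rewrite /= eqxx.
have [u [l [sE ux lx cnt]]] := split_above us Ax.
rewrite /= cnt; case: l => [|y l] in sE lx *.
  rewrite cats0 in sE; rewrite -sE -[size s]size_code; apply: greedy_full; apply: IHs.
  - by case/andP: us.
  - exact: avoids3_sub sub A.
  - exact: avoids3_sub sub B.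
  exact: avoids4_sub sub C.
have Du : decreasing u.
  move=> b c bc lt; have := mem_subseq bc; move=> /(_ b (mem_head _ _)) bu.
  apply: (C x b c y); last by rewrite lx ?mem_head // ux.
  rewrite /= eqxx sE -[[:: b; c; y]]/([:: b; c] ++ [:: y]); apply: cat_subseq => //.
  by rewrite sub1seq mem_head.
have Dl : decreasing (y :: l).
  move=> b c bc lt; apply: (B x b c); first by rewrite /= eqxx sE subseq_suffix.
  by rewrite lt lx // (mem_subseq bc) // !inE eqxx orbT.
rewrite sE code_cat_above; last by move=> a b /ux + /lx; lia.
by rewrite (code_decreasing Du) (code_decreasing Dl) -nseqD; apply: greedy_last.
Qed.

(** If some entry is smaller than the first one, avoiding 2341 makes the
    larger entries decrease: they contribute a block. Otherwise the first entry
    plays the 1 of 1423, and the others avoid 312. *)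
Lemma avoiding_minus_word s : uniq s -> minus_avoiding s -> minus_word (code s).
Proof.
move: {2}(size s).+1 (ltnSn (size s)) => N; elim: N s => // N IHN [|x s] /= lt us [A B C].
  exact/minus_greedy/greedy_nil.
have sub : subseq s (x :: s) by apply: subseq_cons.
have Ax b c : subseq [:: b; c] s -> ~ b < x < c.
  by move=> bc; apply: (A x b c); rewrite /= eqxx.
have [u [l [sE ux lx cnt]]] := split_above us Ax.
have uns : uniq s by case/andP: us.
rewrite cnt; case: l => [|y l] in sE lx *.
  rewrite cats0 in sE; rewrite -sE -[size s]size_code; apply/minus_greedy/greedy_full.
  apply: avoiding_greedy => //; [exact: avoids3_sub sub A | | exact: avoids4_sub sub B].
  move=> a b c abc /andP[bc ca]; apply: (C x a b c); first by rewrite /= eqxx.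
  by rewrite bc ca ux // -sE (mem_subseq abc) // !inE eqxx orbT.
have Du : decreasing u.
  move=> b c bc lt'; have := mem_subseq bc; move=> /(_ b (mem_head _ _)) bu.
  apply: (B x b c y); last by rewrite lx ?mem_head // ux.
  rewrite /= eqxx sE -[[:: b; c; y]]/([:: b; c] ++ [:: y]); apply: cat_subseq => //.
  by rewrite sub1seq mem_head.
rewrite sE code_cat_above; last by move=> a b /ux + /lx; lia.
rewrite (code_decreasing Du); apply: minus_block.
have subl : subseq (y :: l) (x :: s) by rewrite sE -cat_cons; apply: suffix_subseq.
apply: IHN.
- by move: lt; rewrite sE size_cat /=; lia.
- by move: uns; rewrite sE cat_uniq => /and3P[].
by split; [exact: avoids3_sub subl A | exact: avoids4_sub subl B | exact: avoids4_sub subl C].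
Qed.

(** Entries with a small letter cannot begin a pattern that has many larger
    entries behind its first one. *)
Lemma code_lead m e c (s : seq nat) b t : code s = e ++ c -> all (fun z => z < m) e ->
  subseq (b :: t) s -> m <= count (ltn b) t -> subseq (b :: t) (drop (size e) s).
Proof.
elim: e s => [|z e IHe] [|x s] //= [zE cE] /andP[zm em] bt le.
case: (subseq_consP bt) => [[bx ts]|H]; last exact: IHe.
by have := leq_trans le (leq_count_subseq (ltn b) ts); rewrite bx zE leqNgt zm.
Qed.

(** The [k] leading entries dominate everything behind them, so they are the
    [k] entries above [x]. *)
Lemma code_lead_above k c s x : code s = nseq k 0 ++ c -> count (ltn x) s = k ->
  forall y, y \in drop k s -> y <= x.
Proof.
move=> cE cnt y ys; rewrite leqNgt; apply/negP => xy.
have le : all (fun u => y <= u) (take k s).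
  elim: k s cE ys {cnt} => [|k IHk] [|z s] //= [c0 cE] ys; rewrite (IHk s) // andbT.
  by apply: (count0P c0); apply: mem_drop ys.
have szk : k <= size s by rewrite -size_code cE size_cat size_nseq leq_addr.
have : count (ltn x) (take k s) = k.
  rewrite -[RHS](size_takel szk); apply/eqP; rewrite -all_count.
  by apply: sub_all le => u /=; apply: leq_trans.
move: cnt; rewrite -{1}(cat_take_drop k s) count_cat => E1 E2.
have : 0 < count (ltn x) (drop k s) by rewrite -has_count; apply/hasP; exists y.
lia.
Qed.

Lemma greedy_avoiding s : greedy (code s) -> [/\ avoids213 s, avoids312 s & avoids2341 s].
Proof.
move: {2}(code s) (erefl (code s)) => c sc; rewrite sc => G.
elim: G s sc => [|{}c _ IHc|k m] [|x s] //= [].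
- rewrite -{2}[c]/c => E cE; have [A B C] := IHc s cE.
  have above : {in s, forall y, x < y}.
    by apply/allP; rewrite all_count E -cE size_code.
  split=> [a b d|a b d|a b d f] /subseq_consP[[-> H]|H]; do ?[exact: A|exact: B|exact: C].
  - by have := above b; rewrite (mem_subseq H) ?mem_head // => /(_ isT); lia.
  - by have := above d; rewrite (mem_subseq H) ?inE ?eqxx ?orbT // => /(_ isT); lia.
  by have := above f; rewrite (mem_subseq H) ?inE ?eqxx ?orbT // => /(_ isT); lia.
move=> _ /decreasing_code D.
have D2 a b t : subseq (a :: b :: t) s -> ~ a < b.
  by move=> H; apply: D; apply: subseq_trans H; rewrite /= !eqxx sub0seq.
split=> [a b d|a b d|a b d f] /subseq_consP[[-> H]|H].
- by have := D2 _ _ _ H; lia.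
- by have := D2 _ _ [::] (subseq_trans (subseq_cons _ _) H); lia.
- by have := D2 _ _ _ H; lia.
- by have := D2 _ _ [::] (subseq_trans (subseq_cons _ _) H); lia.
- by have := D2 _ _ _ H; lia.
by have := D2 _ _ _ H; lia.
Qed.

(** In each of the three patterns the first entry has a larger one behind it;
    this excludes the entries with letter 0. The head of a block is excluded
    since the entries above it form a decreasing run. *)
Lemma minus_word_avoiding s : minus_word (code s) -> minus_avoiding s.
Proof.
move: {2}(code s) (erefl (code s)) => c sc; rewrite sc => M.
elim: M s sc => [{}c G s sc|k {}c M IH [|x s] //= [cnt sc]].
  rewrite -sc in G; have [A B C] := greedy_avoiding G; split=> // a b e d H.
  have H' : subseq [:: b; e; d] s by apply: subseq_trans H; apply: subseq_cons.
  by have := B _ _ _ H'; lia.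
have [|A B C] := IH (drop k s).
  by rewrite code_drop sc drop_size_cat ?size_nseq.
have low := code_lead_above sc cnt.
have lead b t : subseq (b :: t) s -> 0 < count (ltn b) t -> subseq (b :: t) (drop k s).
  by rewrite -[k in drop k](size_nseq k 0); apply: code_lead sc _; rewrite all_nseq orbT.
have asc b d t : subseq (b :: d :: t) s -> b < d -> d <= x.
  move=> H bd; have S : subseq (b :: d :: t) (drop k s) by apply: lead => //=; rewrite bd.
  by apply: low; apply: (mem_subseq S); rewrite !inE eqxx orbT.
split=> [a b d|a b d f|a b d f] /subseq_consP[[-> H]|H] P.
- by have := asc _ _ _ H; lia.
- by apply: (A a b d) => //; apply: lead => //=; lia.
- by have := asc _ _ _ H; lia.
- by apply: (B a b d f) => //; apply: lead => //=; lia.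
- by have := asc _ _ _ (subseq_trans (subseq_cons _ _) H); lia.
by apply: (C a b d f) => //; apply: lead => //=; lia.
Qed.

(** * Lists that avoid 132, 2341 and 3124 *)

Lemma code_increasing s : increasing s -> code s = rev (iota 0 (size s)).
Proof.
elim: s => // x s IHs I; rewrite [size _]/= rev_iotaS /= IHs => [|b c bc]; last first.
  by apply: I; apply: subseq_trans bc (subseq_cons _ _).
congr (_ :: _); apply/eqP; rewrite -all_count; apply/allP => y ys.
by apply: I; rewrite /= eqxx sub1seq.
Qed.

Lemma increasing_code s k : code s = rev (iota 0 k) -> increasing s.
Proof.
elim: s k => [|x s IHs] [|k]; rewrite ?rev_iotaS //= => -[E sc] b c.
have {}E : count (ltn x) s = size s by rewrite E -(size_code s) sc size_rev size_iota.
case/subseq_consP=> [[-> H]|]; last exact: IHs sc b c.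
have /allP : all (ltn x) s by rewrite all_count E.
by apply; rewrite -sub1seq.
Qed.

Definition below (z i : seq nat) := forall a b, a \in z -> b \in i -> a < b.

Lemma belowP x z i : below (x :: z) i <-> (forall b, b \in i -> x < b) /\ below z i.
Proof.
split=> [B|[xi zi] a b]; last by rewrite inE => /orP[/eqP->|az]; [exact: xi|exact: zi].
by split=> [b|a b az]; apply: B; rewrite ?mem_head // inE az orbT.
Qed.

Lemma count_ge2 x b c t : subseq [:: b; c] t -> x < b -> x < c -> 1 < count (ltn x) t.
Proof. by move=> H xb xc; have := leq_count_subseq (ltn x) H; rewrite /= xb xc. Qed.

(** The entries of the block have at most one larger entry behind them. This
    excludes 132 and 2341 at once; for 3124 both the last entry of the block and
    the 4 of the pattern would exceed the 3. *)
Lemma plus_avoiding_block k c s : (forall t, code t = c -> plus_avoiding t) ->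
  code s = nseq k 1 ++ 0 :: c -> plus_avoiding s.
Proof.
move=> IHc; elim: k s => [|k IHk] [|x s] //= [cnt sc].
  have [A B C] := IHc s sc; have low := count0P cnt.
  split=> [a b d|a b d f|a b d f] /subseq_consP[[-> H]|H] P; try by [apply: A H P|apply: B H P|apply: C H P].
  - by have := low b; rewrite (mem_subseq H) ?inE ?eqxx ?orbT // => /(_ isT); lia.
  - by have := low b; rewrite (mem_subseq H) ?inE ?eqxx ?orbT // => /(_ isT); lia.
  by have := low f; rewrite (mem_subseq H) ?inE ?eqxx ?orbT // => /(_ isT); lia.
have [A B C] := IHk s sc.
split=> [a b d|a b d f|a b d f] /subseq_consP[[-> H]|H] P; try by [apply: A H P|apply: B H P|apply: C H P].
- by have := count_ge2 H (x := x); rewrite cnt; lia.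
- have H' : subseq [:: b; d] s by apply: subseq_trans H; rewrite -[[:: b; d; f]]/([:: b; d] ++ [:: f]); apply: prefix_subseq.
  by have := count_ge2 H' (x := x); rewrite cnt; lia.
have lead : subseq [:: b; d; f] (drop (size (rcons (nseq k 1) 0)) s).
  apply: (@code_lead 2 _ c) => //=; last by lia.
    by rewrite cat_rcons.
  by rewrite all_rcons all_nseq orbT.
have fs : f \in drop k.+1 s.
  by have := mem_subseq lead; rewrite size_rcons size_nseq; apply; rewrite !inE eqxx !orbT.
have ks : k < size s by rewrite -(size_code s) sc size_cat size_nseq /=; lia.
have E : drop k s = nth 0 s k :: drop k.+1 s by exact: drop_nth.
have c0 : count (ltn (nth 0 s k)) (drop k.+1 s) = 0.
  by have := code_drop k s; rewrite E sc drop_size_cat ?size_nseq //= => -[].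
have H2 : subseq [:: nth 0 s k; f] s.
  by apply: subseq_trans (drop_subseq s k); rewrite E /= eqxx sub1seq.
by have := count_ge2 H2 (x := x); have := count0P c0 fs; rewrite cnt; lia.
Qed.

(** The largest entries are collected in [i]; if [x] has at least [size i]
    larger entries then it lies below all of [i]. *)
Lemma count_top x z i m : below z i -> count (ltn x) (z ++ i) = size i + m ->
  (forall b, b \in i -> x < b) /\ count (ltn x) z = m.
Proof.
move=> zi; rewrite count_cat => E.
have I : forall b, b \in i -> x < b.
  move=> b bi; rewrite ltnNge; apply/negP => bx.
  have z0 : count (ltn x) z = 0.
    apply/eqP; rewrite -leqn0 leqNgt -has_count; apply/hasPn => a az /=.
    by have := zi a b az bi; lia.
  have : count (ltn x) i = size i by have := count_size (ltn x) i; lia.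
  by move/eqP; rewrite -all_count => /allP/(_ b bi) /=; lia.
split=> //; have : count (ltn x) i = size i by apply/eqP; rewrite -all_count; apply/allP.
by lia.
Qed.

Lemma stairs_shape k q s : code s = nseq q k ++ rev (iota 0 k) ->
  exists z i, [/\ s = z ++ i, size i = k, size z = q, decreasing z & increasing i /\ below z i].
Proof.
elim: q s => [|q IHq] s.
  move=> sc; exists [::], s; split=> //; first by rewrite -(size_code s) sc size_rev size_iota.
  by split=> //; exact: increasing_code sc.
case: s => //= x s [cnt /IHq[z [i [sE szi szz D [I zi]]]]].
have [xi z0] : (forall b, b \in i -> x < b) /\ count (ltn x) z = 0.
  by apply: count_top zi _; rewrite -sE cnt szi addn0.
exists (x :: z), i; split; rewrite /= ?sE ?szz //; first by apply/decreasing_cons.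
by split=> // a b; rewrite inE => /orP[/eqP->|az]; [exact: xi|exact: zi].
Qed.

(** The increasing end [i] lies above everything; the remaining entries
    decrease, except for the maximum [y] that is inserted among them. *)
Lemma flat_shape k p q s : code s = nseq p k.+1 ++ nseq q.+1 k ++ rev (iota 0 k) ->
  exists u y v i, [/\ s = (u ++ y :: v) ++ i, decreasing (u ++ v), {in u ++ v, forall a, a <= y},
     increasing i & size i = k /\ below (u ++ y :: v) i].
Proof.
elim: p s => [|p IHp] s.
  case/stairs_shape => [[|y v] [i [sE szi // szz D [I zi]]]].
  move/decreasing_cons: D => [c0 D]; exists [::], y, v, i; split=> //.
  by move=> a av; apply: count0P c0 a av.
case: s => //= x s [cnt /IHp[u [y [v [i [sE D uy I [szi zi]]]]]]].
have [xi z1] : (forall b, b \in i -> x < b) /\ count (ltn x) (u ++ y :: v) = 1.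
  by apply: count_top zi _; rewrite -sE cnt szi addn1.
have xy : x < y.
  rewrite ltnNge; apply/negP => yx; move: z1; rewrite count_cat /= ltnNge yx add0n -count_cat.
  move=> c1; have : has (ltn x) (u ++ v) by rewrite has_count c1.
  by case/hasP => a /uy /=; lia.
have c0 : count (ltn x) (u ++ v) = 0.
  by move: z1; rewrite !count_cat /= xy; lia.
exists (x :: u), y, v, i; split; rewrite ?sE //.
- by apply/decreasing_cons.
- by move=> a; rewrite inE => /orP[/eqP->|/uy//]; exact: ltnW.
by split=> //; apply/belowP.
Qed.

(** The only ascents outside the increasing end lead to [y]. *)
Lemma flat_ascent u y v a b : decreasing (u ++ v) -> {in u ++ v, forall a, a <= y} ->
  subseq [:: a; b] (u ++ y :: v) -> a < b -> b = y.
Proof.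
move=> D uy /subseq_catP[[|[|m]] [s1 s2]] ab.
- case: (subseq_consP s2) => [[ay bv]|abv].
    by rewrite sub1seq in bv; have := uy b; rewrite mem_cat bv orbT => /(_ isT); lia.
  by case: (D a b) => //; apply: subseq_suffix.
- have [[-> //]|bv] := subseq_consP s2.
  by case: (D a b) => //; rewrite sub1seq in s1; rewrite sub1seq in bv; apply: subseq_cat2.
case: (D a b) => //; apply: subseq_prefix; apply: subseq_trans s1.
by rewrite /= !eqxx ?sub0seq.
Qed.

Lemma plus_avoiding_flat k p q s : code s = flat k p q -> plus_avoiding s.
Proof.
move=> /flat_shape[u [y [v [i [-> D uy I [_ zi]]]]]].
set z := u ++ y :: v in zi *.
have asc a b t : subseq [:: a, b & t] z -> a < b -> b = y.
  by move=> H; apply: (flat_ascent D uy); apply: subseq_trans H; rewrite /= !eqxx sub0seq.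
have zy a : a \in z -> a <= y.
  rewrite mem_cat inE => /or3P[au|/eqP->//|av]; apply: uy; by rewrite mem_cat ?au ?av ?orbT.
have inc b c t : subseq [:: b, c & t] i -> b < c.
  by move=> H; apply: I; apply: subseq_trans H; rewrite /= !eqxx sub0seq.
have tl (a : nat) t w : subseq (a :: t) w -> subseq t w.
  by apply: subseq_trans; apply: subseq_cons.
have hd (a : nat) t w : subseq (a :: t) w -> a \in w by move=> H; rewrite (mem_subseq H) ?mem_head.
split=> [a b c|a b c d|a b c d] /subseq_catP[[|[|[|m]]] [s1 s2]] P.
- by have := inc _ _ _ (tl _ _ _ s2); lia.
- by have := inc _ _ _ s2; lia.
- by have := zi b c (hd _ _ _ (tl _ _ _ s1)) (hd _ _ _ s2); lia.
- have s3 : subseq [:: a; c] z.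
    apply: subseq_trans s1.
    by apply: (@subseq_cat2 a c [:: a] [:: b, c & take m [::]]); rewrite !inE eqxx ?orbT.
  by have := asc _ _ _ s1; have := asc _ _ _ s3; lia.
- by have := inc _ _ _ (tl _ _ _ (tl _ _ _ s2)); lia.
- by have := inc _ _ _ (tl _ _ _ s2); lia.
- by have := inc _ _ _ s2; lia.
- by have := asc _ _ _ s1; have := asc _ _ _ (tl _ _ _ s1); lia.
- by have := inc _ _ _ s2; lia.
- by have := zi a b (hd _ _ _ s1) (hd _ _ _ s2); lia.
- by have := zi a c (hd _ _ _ s1) (hd _ _ _ s2); lia.
by have := asc _ _ _ (tl _ _ _ s1); have := zy _ (hd _ _ _ s1); lia.
Qed.

Lemma plus_word_avoiding s : plus_word (code s) -> plus_avoiding s.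
Proof.
move: {2}(code s) (erefl (code s)) => c sc; rewrite sc => H.
elim: H s sc => [[|//] _|k {}c _ IH s sc|k p q _ s sc].
- by split=> a b d.
- exact: plus_avoiding_block IH sc.
exact: plus_avoiding_flat sc.
Qed.

Lemma filter_split (P : pred nat) s x t : filter P s = x :: t ->
  exists u v, [/\ s = u ++ x :: v, {in u, forall a, ~~ P a} & filter P v = t].
Proof.
elim: s => //= y s IHs; case: ifP => Py.
  by case=> <- <-; exists [::], s.
case/IHs => u [v [-> H F]]; exists (y :: u), v; split=> //.
by move=> a; rewrite inE => /orP[/eqP->|/H//]; rewrite Py.
Qed.

(** Let [k] entries be larger than the first one; they increase since 132 is
    avoided. For [k = 1], avoiding 3124 and 132 makes the entries before the
    larger one decrease and exceed those behind it: this is a block. For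
    [k > 1], avoiding 2341 leaves only larger entries behind the second larger
    one, and avoiding 3124 makes all the smaller entries decrease: this is the
    shape of a flat word. *)
Lemma avoiding_plus_word s : uniq s -> plus_avoiding s -> plus_word (code s).
Proof.
move: {2}(size s).+1 (ltnSn (size s)) => N; elim: N s => // N IHN [|x s] /= lt; first by move=> _ _; exact: plus_nil.
move=> /andP[xs us] [A B C].
have sub : subseq s (x :: s) by apply: subseq_cons.
have low a : a \in s -> ~~ (x < a) -> a < x.
  by move=> ias; rewrite -leqNgt leq_eqVlt => /orP[/eqP E|//]; move: xs; rewrite -E ias.
have inc b c : subseq [:: b; c] s -> x < b -> x < c -> b < c.
  move=> bc xb xc; rewrite ltnNge; apply/negP => cb.
  have ne : b != c.
    by have := subseq_uniq bc us; rewrite /= inE andbT.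
  by apply: (A x b c); [rewrite /= eqxx|lia].
case fE : (filter (ltn x) s) => [|y t].
  have -> : count (ltn x) s = 0 by rewrite -size_filter fE.
  apply: (@plus_block 0); apply: IHN => //.
  by split; [exact: avoids3_sub sub A|exact: avoids4_sub sub B|exact: avoids4_sub sub C].
have [u [v [sE ux fv]]] := filter_split fE.
have xy : x < y.
  have : y \in filter (ltn x) s by rewrite fE mem_head.
  by rewrite mem_filter => /andP[].
have ulow a : a \in u -> a < x by move=> au; apply: low (ux a au); rewrite sE mem_cat au.
have cnt : count (ltn x) s = (size t).+1 by rewrite -size_filter fE.
rewrite cnt; case: t => [|y2 t] in fE fv cnt *.
  have vlow a : a \in v -> a < x.
    move=> av; apply: low; first by rewrite sE mem_cat inE av !orbT.
    by apply/negP => xa; have : a \in filter (ltn x) v by [rewrite mem_filter /= xa]; rewrite fv.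
  have Du : decreasing u.
    move=> b c bc lt'; apply: (C x b c y).
      by rewrite /= eqxx sE -[[:: b; c; y]]/([:: b; c] ++ [:: y]) cat_subseq ?sub1seq ?mem_head.
    by rewrite lt' xy ulow // (mem_subseq bc) // !inE eqxx orbT.
  have -> : code s = nseq (size u) 1 ++ 0 :: code v.
    rewrite sE (@code_cat_decreasing _ _ 1) => [|//|a au] /=.
      congr (_ ++ _ :: _); apply/eqP; rewrite -leqn0 leqNgt -has_count; apply/hasPn => b bv /=.
      by have := vlow b bv; lia.
    have -> : a < y by apply: ltn_trans xy; exact: ulow.
    apply/eqP; rewrite eqSS -leqn0 leqNgt -has_count; apply/hasPn => b bv /=.
    apply/negP => ab; apply: (A a y b).
      by rewrite sE; apply: subseq_trans (subseq_cons _ _); rewrite -[[:: a; y; b]]/([:: a] ++ [:: y; b]) cat_subseq ?sub1seq //= eqxx sub1seq.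
    by rewrite ab; have := vlow b bv; lia.
  apply: (@plus_block (size u).+1).
  have subv : subseq v (x :: s).
    by rewrite sE -cat_cons; apply: subseq_suffix; apply: subseq_cons.
  apply: IHN; first by move: lt; rewrite sE size_cat /=; lia.
    by move: us; rewrite sE cat_uniq /= => /and4P[].
  by split; [exact: avoids3_sub subv A|exact: avoids4_sub subv B|exact: avoids4_sub subv C].
have [u2 [v2 [vE ux2 fv2]]] := filter_split fv.
have xy2 : x < y2.
  have : y2 \in filter (ltn x) v by rewrite fv mem_head.
  by rewrite mem_filter => /andP[].
have u2low a : a \in u2 -> a < x.
  by move=> au; apply: low (ux2 a au); rewrite sE vE !mem_cat inE mem_cat au !orbT.
have yy2 : y < y2.
  apply: inc => //; rewrite sE vE; apply: subseq_suffix; rewrite /= eqxx sub1seq.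
  by rewrite mem_cat mem_head orbT.
have v2up a : a \in v2 -> x < a.
  move=> av; rewrite ltnNge; apply/negP => ax.
  have {}ax : a < x by apply: low; rewrite -?leqNgt // sE vE !(mem_cat, inE) av !orbT.
  apply: (B x y y2 a); last by rewrite ax xy yy2.
  rewrite /= eqxx sE vE; apply: subseq_suffix; rewrite /= eqxx; apply: subseq_suffix.
  by rewrite /= eqxx sub1seq.
have v2E : v2 = t by rewrite -fv2; apply/esym/all_filterP/allP.
have Duu : decreasing (u ++ u2).
  move=> b c bc lt'; apply: (C x b c y2).
    rewrite /= eqxx sE vE -[[:: b; c; y2]]/([:: b; c] ++ [:: y2]) -cat_rcons catA.
    apply: cat_subseq; last by rewrite sub1seq mem_head.
    apply: subseq_trans bc _; apply: cat_subseq; last exact: subseq_refl.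
    by rewrite -cats1; apply: prefix_subseq.
  have : c \in u ++ u2 by rewrite (mem_subseq bc) // !inE eqxx orbT.
  by rewrite mem_cat => /orP[/ulow|/u2low]; rewrite lt' xy2 => ->.
have Iv : increasing (y2 :: v2).
  move=> b c bc; have mem d : d \in [:: b; c] -> x < d.
    by move/(mem_subseq bc); rewrite inE => /orP[/eqP->//|/v2up].
  apply: inc; rewrite ?mem ?inE ?eqxx ?orbT //.
  apply: subseq_trans bc _; rewrite sE vE; apply: subseq_suffix; apply: subseq_trans (subseq_cons _ _).
  exact: suffix_subseq.
have up a b : a < x -> b \in y2 :: v2 -> a < b.
  by move=> ax; rewrite inE => /orP[/eqP->|/v2up]; lia.
have cup a : a < x -> count (ltn a) (y2 :: v2) = (size t).+1.
  move=> ax; rewrite -v2E; apply/eqP; rewrite -(all_count _ (y2 :: v2)); apply/allP => b; exact: up.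
have cu2 a : (forall b, b \in u2 -> ~~ (a < b)) -> count (ltn a) u2 = 0.
  by move=> H; apply/eqP; rewrite -leqn0 leqNgt -has_count; apply/hasPn.
have -> : (size (y2 :: t)).+1 :: code s = flat (size t).+1 (size u) (size u2).
  congr (_ :: _); rewrite sE vE (@code_cat_decreasing _ _ (size t).+2); first last.
  - move=> a au; rewrite /= count_cat cup ?ulow // cu2.
      by rewrite (ltn_trans (ulow a au) xy).
    move=> b bu; apply/negP; apply: Duu; exact: subseq_cat2.
  - by move=> b c bc; apply: Duu; apply: subseq_prefix.
  congr (_ ++ _); rewrite /= count_cat cu2; last by move=> b /u2low; lia.
  congr (_ :: _).
    apply/eqP; rewrite add0n -v2E -(all_count _ (y2 :: v2)); apply/allP => b; rewrite inE => /orP[/eqP->//|bv].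
    apply: ltn_trans yy2 _; apply: Iv; by rewrite /= eqxx sub1seq.
  rewrite (@code_cat_decreasing _ _ (size t).+1) => [||a /u2low /cup //].
    by rewrite (code_increasing Iv) /= v2E.
  by move=> b c bc; apply: Duu; apply: subseq_suffix.
exact: plus_flat.
Qed.

(** * Braid relations for divided differences *)

Import GRing.Theory.
Local Open Scope ring_scope.

(** The identities between polynomials are proved over an arbitrary
    commutative ring and then instantiated. *)
Lemma commuting_quotients (R : comNzRingType) (a b z p p' q q' u f sf tf tsf : R) :
  b * z = p - p' -> b * q = f - tf -> b * q' = sf - tsf -> a * p = f - sf ->
  a * p' = tf - tsf -> u = q' -> b * (a * z) = b * (q - u).
Proof.
move=> E1 E2 E3 E4 E5 ->; rewrite mulrCA E1 mulrBr E4 E5 mulrBr E2 E3; ring.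
Qed.

(** Both sides of the braid relation are the quotient of the antisymmetrizer
    by the Vandermonde product; here [a], [b] and [c] are the differences of the
    variables. *)
Lemma antisymmetrizer_quotient (R : comNzRingType)
    (a b c k h sh g sg tg stg f sf tf tsf stf stsf : R) : c = a + b ->
  a * k = h - sh -> b * h = g - tg -> c * sh = sg - stg -> sg = g ->
  a * g = f - sf -> c * tg = tf - tsf -> b * stg = stf - stsf ->
  c * (b * (a * k)) = f - sf - tf + tsf + stf - stsf.
Proof.
move=> cE Ek Eh Esh sgE Eg Etg Estg; rewrite Ek.
transitivity (c * (b * h) - b * (c * sh)); first by ring.
rewrite Eh Esh sgE.
transitivity (a * g - c * tg + b * stg); first by rewrite cE; ring.
rewrite Eg Etg Estg; ring.
Qed.

Lemma sub_chain (V : zmodType) (x y z : V) : x - z = (x - y) + (y - z).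
Proof. by rewrite addrA subrK. Qed.

Lemma sub_chain' (V : zmodType) (x y z : V) : x - z = (y - z) + (x - y).
Proof. by rewrite [RHS]addrC -sub_chain. Qed.

Lemma antisym_reorder (V : zmodType) (f a b c d e : V) :
  f - a - b + c + d - e = f - b - a + d + c - e.
Proof. by rewrite -(addrA f) -(addrA f (- b)) (addrC (- a)) -!addrA (addrA c) (addrC c) !addrA. Qed.

Lemma equal_quotients (R : idomainType) (a b c u v p q : R) :
  a != 0 -> b != 0 -> c != 0 -> c * (b * (a * u)) = p -> c * (a * (b * v)) = q -> p = q -> u = v.
Proof.
move=> a0 b0 c0 <- <- /(mulfI c0); rewrite mulrCA => /(mulfI a0) /(mulfI b0).
exact.
Qed.

Section DividedDifference.
Variable n : nat.
Implicit Types (i j k : 'I_n) (f g : {mpoly int[n]}) (m : 'X_{1..n}).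

Lemma ddiffP i j f : ('X_i - 'X_j) * ddiff i j f = f - msym (tperm i j) f.
Proof. exact/eqP/(xchooseP (ddiff_exists i j f)). Qed.

Lemma subX_neq0 i j : i != j -> ('X_i - 'X_j : {mpoly int[n]}) != 0.
Proof.
move=> ij; apply/eqP => /(congr1 (mcoeff U_(i)%MM)).
by rewrite mcoeffB !mcoeffXU eqxx eq_sym (negbTE ij) mcoeff0 subr0.
Qed.

Lemma ddiff_unique i j f g : i != j ->
  ('X_i - 'X_j) * g = f - msym (tperm i j) f -> g = ddiff i j f.
Proof. by move=> ij; rewrite -ddiffP => /(mulfI (subX_neq0 ij)). Qed.

Lemma msym_X (s : 'S_n) i : msym s 'X_i = 'X_(s i) :> {mpoly int[n]}.
Proof.
rewrite msymX; congr 'X_[_]; apply/mnmP => l; rewrite !mnmE.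
by rewrite -(inj_eq (@perm_inj _ s)) permKV.
Qed.

Lemma msym_tpermK i j f : msym (tperm i j) (msym (tperm i j) f) = f.
Proof. by rewrite -msymMm tperm2 msym1m. Qed.

Lemma msym_ddiff i j f : i != j -> msym (tperm i j) (ddiff i j f) = ddiff i j f.
Proof.
move=> ij; apply: ddiff_unique => //; apply: oppr_inj; rewrite -mulNr !opprB.
have := congr1 (msym (tperm i j)) (ddiffP i j f).
by rewrite msymM !msymB !msym_X tpermL tpermR msym_tpermK.
Qed.

Lemma tperm_commute i j k l : i != k -> i != l -> j != k -> j != l ->
  (tperm i j * tperm k l = tperm k l * tperm i j)%g.
Proof.
move=> ik il jk jl; have := tpermJ k l (tperm i j).
by rewrite !tpermD // conjgE tpermV => {1}<-; rewrite !mulgA tperm2 mul1g.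
Qed.

Lemma tperm_braid i j k : i != j -> i != k -> j != k ->
  (tperm i j * (tperm j k * tperm i j) = tperm j k * (tperm i j * tperm j k))%g.
Proof.
move=> ij ik jk; have := tpermJ j k (tperm i j); have := tpermJ i j (tperm j k).
rewrite !conjgE !tpermV !tpermR !tpermL => -> ->.
by rewrite !tpermD // eq_sym.
Qed.

Lemma msym_tpermC i j k l f : i != k -> i != l -> j != k -> j != l ->
  msym (tperm i j) (msym (tperm k l) f) = msym (tperm k l) (msym (tperm i j) f).
Proof.
by move=> ik il jk jl; rewrite -!msymMm (@tperm_commute i j).
Qed.

Lemma msym_ddiffC i j k l f : k != l -> i != k -> i != l -> j != k -> j != l ->
  msym (tperm i j) (ddiff k l f) = ddiff k l (msym (tperm i j) f).
Proof.
move=> kl ik il jk jl; apply: ddiff_unique => //.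
have := congr1 (msym (tperm i j)) (ddiffP k l f).
by rewrite msymM !msymB !msym_X (tpermD ik jk) (tpermD il jl) (@msym_tpermC i j k l).
Qed.

Lemma ddiffC i j k l f : i != j -> k != l -> i != k -> i != l -> j != k -> j != l ->
  ddiff i j (ddiff k l f) = ddiff k l (ddiff i j f).
Proof.
move=> ij kl ik il jk jl; apply: esym; apply: ddiff_unique => //.
apply: (mulfI (subX_neq0 kl)).
have E1 := ddiffP k l (ddiff i j f).
have E5 := ddiffP i j (msym (tperm k l) f).
rewrite (@msym_ddiffC k l i j f) ?(@msym_tpermC i j k l f) // in E1 E5; [|by rewrite eq_sym..].
exact: (commuting_quotients E1 (ddiffP k l f) (ddiffP k l _) (ddiffP i j f) E5 (msym_ddiffC _ _ _ _ _ _)).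
Qed.

Lemma ddiff_antisym_l i j k f : i != j -> i != k -> j != k ->
  let s := msym (tperm i j) in let t := msym (tperm j k) in
  ('X_i - 'X_k) * (('X_j - 'X_k) * (('X_i - 'X_j) * ddiff i j (ddiff j k (ddiff i j f))))
  = f - s f - t f + t (s f) + s (t f) - s (t (s f)).
Proof.
move=> ij ik jk s t.
have ki : k != i by rewrite eq_sym.
have ji : j != i by rewrite eq_sym.
have Etg : ('X_i - 'X_k) * t (ddiff i j f) = t f - t (s f).
  have := congr1 t (ddiffP i j f).
  by rewrite /t msymM !msymB !msym_X tpermL (@tpermD _ j k i).
have Estg : ('X_j - 'X_k) * s (t (ddiff i j f)) = s (t f) - s (t (s f)).
  by have := congr1 s Etg; rewrite /s msymM !msymB !msym_X tpermL tpermD.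
apply: (antisymmetrizer_quotient _ (ddiffP i j _) (ddiffP j k _) _ (msym_ddiff f ij) (ddiffP i j f) Etg Estg).
  exact: sub_chain.
have := congr1 s (ddiffP j k (ddiff i j f)).
by rewrite /s msymM !msymB !msym_X tpermR (tpermD ik jk).
Qed.

Lemma ddiff_antisym_r i j k f : i != j -> i != k -> j != k ->
  let s := msym (tperm i j) in let t := msym (tperm j k) in
  ('X_i - 'X_k) * (('X_i - 'X_j) * (('X_j - 'X_k) * ddiff j k (ddiff i j (ddiff j k f))))
  = f - t f - s f + s (t f) + t (s f) - t (s (t f)).
Proof.
move=> ij ik jk s t.
have ki : k != i by rewrite eq_sym.
have ji : j != i by rewrite eq_sym.
have Esg : ('X_i - 'X_k) * s (ddiff j k f) = s f - s (t f).
  have := congr1 s (ddiffP j k f).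
  by rewrite /s msymM !msymB !msym_X tpermR tpermD.
have Etsg : ('X_i - 'X_j) * t (s (ddiff j k f)) = t (s f) - t (s (t f)).
  by have := congr1 t Esg; rewrite /t msymM !msymB !msym_X tpermR (@tpermD _ j k i).
apply: (antisymmetrizer_quotient _ (ddiffP j k _) (ddiffP i j _) _ (msym_ddiff f jk) (ddiffP j k f) Esg Etsg).
  exact: sub_chain'.
have := congr1 t (ddiffP i j (ddiff j k f)).
by rewrite /t msymM !msymB !msym_X tpermL (tpermD ji ki).
Qed.

Lemma ddiff_braid i j k f : i != j -> i != k -> j != k ->
  ddiff i j (ddiff j k (ddiff i j f)) = ddiff j k (ddiff i j (ddiff j k f)).
Proof.
move=> ij ik jk.
have B : msym (tperm i j) (msym (tperm j k) (msym (tperm i j) f)) =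
         msym (tperm j k) (msym (tperm i j) (msym (tperm j k) f)).
  by rewrite -!msymMm tperm_braid.
apply: (equal_quotients (subX_neq0 ij) (subX_neq0 jk) (subX_neq0 ik)
  (ddiff_antisym_l f ij ik jk) (ddiff_antisym_r f ij ik jk)).
by rewrite B; apply: antisym_reorder.
Qed.

(** * Monomials of a divided difference *)

Definition set_exp i j m (a b : nat) : 'X_{1..n} :=
  [multinom (if k == i then a else if k == j then b else m k) | k < n].

Lemma set_exp_id i j m : set_exp i j m (m i) (m j) = m.
Proof. by apply/mnmP => k; rewrite mnmE; case: eqP => [->//|_]; case: eqP => [->|]. Qed.

Lemma mcoeff_Xmul0 i f m : m i = 0%N -> ('X_i * f)@_m = 0.
Proof.
move=> mi; apply/eqP; rewrite mcoeff_eq0; apply/negP.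
rewrite mulrC (perm_mem (msuppMX _ _)) => /mapP[m' _ mE].
by move: mi; rewrite mE mnmDE mnm1E eqxx.
Qed.

Lemma mcoeff_Xmul i f m : ('X_i * f)@_(U_(i) + m) = f@_m.
Proof. by rewrite mulrC mcoeffMX. Qed.

Section Fixed.
Variables (i j : 'I_n) (ij : i != j) (f : {mpoly int[n]}) (m : 'X_{1..n}).
Local Notation F a b := (f@_(set_exp i j m a b)).
Local Notation G a b := ((ddiff i j f)@_(set_exp i j m a b)).

Lemma set_expSl a b : set_exp i j m a.+1 b = (U_(i) + set_exp i j m a b)%MM.
Proof.
apply/mnmP => k; rewrite mnmDE mnm1E !mnmE (eq_sym i k).
by case: (k == i); case: (k == j).
Qed.

Lemma set_expSr a b : set_exp i j m a b.+1 = (U_(j) + set_exp i j m a b)%MM.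
Proof.
apply/mnmP => k; rewrite mnmDE mnm1E !mnmE (eq_sym j k).
by have [->|ki] := eqVneq k i; rewrite ?(negbTE ij) //; case: (k == j).
Qed.

Lemma mcoeff_msym a b : (msym (tperm i j) f)@_(set_exp i j m a b) = F b a.
Proof.
rewrite mcoeff_sym; congr (f@_ _); apply/mnmP => k; rewrite !mnmE.
by case: tpermP => [->|->|/eqP/negbTE-> /eqP/negbTE->] //; rewrite !eqxx // eq_sym (negbTE ij).
Qed.

Lemma ddiff_coeff_mul a b :
  ('X_i * ddiff i j f)@_(set_exp i j m a b) - ('X_j * ddiff i j f)@_(set_exp i j m a b)
  = F a b - F b a.
Proof. by rewrite -mcoeffB -mulrBl ddiffP mcoeffB mcoeff_msym. Qed.

(** The recursion along a string of monomials in which only the exponents of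
    the two variables vary, with constant sum. *)
Lemma ddiff_coeffS a b : G a b.+1 - G a.+1 b = F a.+1 b.+1 - F b.+1 a.+1.
Proof.
rewrite -ddiff_coeff_mul [in RHS]set_expSl mcoeff_Xmul -set_expSl.
by rewrite [in X in _ = _ - X]set_expSr mcoeff_Xmul.
Qed.

Lemma ddiff_coeff0 b : G 0 b = F b.+1 0 - F 0 b.+1.
Proof.
have mi : set_exp i j m 0 b.+1 i = 0%N by rewrite mnmE eqxx.
have := ddiff_coeff_mul 0 b.+1; rewrite (mcoeff_Xmul0 _ mi) set_expSr (mcoeff_Xmul j).
by rewrite -set_expSr sub0r => /(congr1 -%R); rewrite opprB opprK.
Qed.

Lemma ddiff_coeffC a b : G a b = G b a.
Proof.
rewrite -{1}(msym_ddiff f ij) mcoeff_sym; congr (_@_ _); apply/mnmP => k; rewrite !mnmE.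
by case: tpermP => [->|->|/eqP/negbTE-> /eqP/negbTE->] //; rewrite !eqxx // eq_sym (negbTE ij).
Qed.

(** The recursion propagates zeros from the end [a = 0] of the string. *)
Lemma ddiff_coeff_eq0 a b :
  (forall c, c <= a -> F c ((a + b).+1 - c) = 0 /\ F ((a + b).+1 - c) c = 0)%N -> G a b = 0.
Proof.
elim: a b => [|a IHa] b F0.
  by rewrite ddiff_coeff0; have [] := F0 0%N (leqnn _); rewrite !subn0 add0n => -> ->; rewrite subr0.
have := ddiff_coeffS a b; rewrite IHa => [|c le]; last first.
  by rewrite addnS -addSn; apply: F0; apply: leqW.
have [] := F0 a.+1 (leqnn _); rewrite addSn -addnS -addSn addnC addnK => -> ->.
by rewrite subrr sub0r => /eqP; rewrite oppr_eq0 => /eqP.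
Qed.

(** A monomial of the divided difference lies between a monomial of
    [f] and its mirror image. By symmetry only the lower half of the string has
    to be considered. *)
Lemma ddiff_coeff_support a b : G a b != 0 ->
  exists c d, [/\ (c + d = (a + b).+1)%N, F c d != 0, (minn c d <= a)%N & (a < maxn c d)%N].
Proof.
suff W a' b' : (a' <= b')%N -> G a' b' != 0 ->
    exists c d, [/\ (c + d = (a' + b').+1)%N, F c d != 0 & (minn c d <= a')%N].
  move=> G0; have [le|lt] := leqP a b.
    by have [c [d [E Fcd mn]]] := W _ _ le G0; exists c, d; split=> //; lia.
  have [||c [d [E Fcd mn]]] := W b a; [exact: ltnW|by rewrite ddiff_coeffC|].
  by exists c, d; split=> //; lia.
move=> le G0.
have [/existsP[c /orP[Fc|Fc]]|] := boolP [exists c : 'I_a'.+1,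
    (F c ((a' + b').+1 - c) != 0) || (F ((a' + b').+1 - c) c != 0)].
- exists c, ((a' + b').+1 - c)%N; split=> //; have := ltn_ord c; lia.
- exists ((a' + b').+1 - c)%N, c; split=> //; have := ltn_ord c; lia.
move=> /existsPn F0; case/eqP: G0; apply: ddiff_coeff_eq0 => c lec.
by have /norP[/negPn/eqP Fc /negPn/eqP Fc'] := F0 (Ordinal (lec : (c < a'.+1)%N)).
Qed.

End Fixed.

Lemma ddiff_X i j m : i != j -> m i = m j -> ddiff i j 'X_[U_(i) + m] = 'X_[m] :> {mpoly int[n]}.
Proof.
move=> ij mij; apply: esym; apply: ddiff_unique => //.
rewrite mulrBl -!mpolyXD msymX; congr (_ - 'X_[_]).
apply/mnmP => k; rewrite !mnmE tpermV; case: tpermP => [->|->|/eqP/negbTE ki /eqP/negbTE kj].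
- by rewrite eq_sym mij.
- by rewrite !eqxx mij.
by rewrite !(eq_sym _ k) ki kj.
Qed.

(** For exponents below the staircase this is injective, and the Lehmer code
    of a permutation is sent to its word. *)
Definition coword m : seq nat := [seq (n - k.+1 - m k)%N | k : 'I_n].

Definition under_staircase m := [forall k : 'I_n, (m k <= n - k.+1)%N].

Lemma under_set_exp i j m a b : under_staircase m -> (a <= n - i.+1)%N -> (b <= n - j.+1)%N ->
  under_staircase (set_exp i j m a b).
Proof.
move=> /forallP um la lb; apply/forallP => k; rewrite mnmE.
by have [->|_] := eqVneq k i; last have [->|_] := eqVneq k j.
Qed.

Lemma enum_adjacent i j : j = i.+1 :> nat ->
  exists e r, [/\ enum 'I_n = e ++ i :: j :: r, size e = i,
                 (forall k, k \in e -> (k < i)%N) & (forall k, k \in r -> (j < k)%N)].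
Proof.
move=> ji; exists (take i (enum 'I_n)), (drop j.+1 (enum 'I_n)).
have si : (i < size (enum 'I_n))%N by rewrite size_enum_ord.
have sj : (j < size (enum 'I_n))%N by rewrite size_enum_ord.
split.
- rewrite -{1}(cat_take_drop i (enum 'I_n)) (drop_nth i si) (nth_ord_enum i i) -ji.
  by rewrite (drop_nth i sj); congr (_ ++ _ :: _ :: _); exact: nth_ord_enum.
- by have := size_take i (enum 'I_n); rewrite si.
- move=> k /(map_f val); rewrite map_take val_enum_ord take_iota mem_iota /=; lia.
move=> k /(map_f val); rewrite map_drop val_enum_ord drop_iota mem_iota /=; lia.
Qed.

Lemma size_coword m : size (coword m) = n.
Proof. by rewrite size_map size_enum_ord. Qed.

Lemma nth_coword m k : nth 0%N (coword m) k = (n - k.+1 - m k)%N.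
Proof.
rewrite /coword /image_mem (nth_map k) ?size_enum_ord //.
by congr (_ - _ - _)%N; [congr (_.+1); congr val|congr (m _)]; exact: nth_ord_enum.
Qed.

Lemma coword_inj m m' : under_staircase m -> under_staircase m' -> coword m = coword m' -> m = m'.
Proof.
move=> /forallP um /forallP um' E; apply/mnmP => k.
by have := nth_coword m k; rewrite E nth_coword; have := um k; have := um' k; lia.
Qed.

Lemma coword_set_exp i j m : j = i.+1 :> nat ->
  exists e r, size e = i /\ forall a b,
    coword (set_exp i j m a b) = e ++ (n - i.+1 - a)%N :: (n - j.+1 - b)%N :: r.
Proof.
move=> ji; have [e [r [eE sz He Hr]]] := enum_adjacent ji.
exists [seq (n - k.+1 - m k)%N | k <- e], [seq (n - k.+1 - m k)%N | k <- r].
split=> [|a b]; first by rewrite size_map.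
rewrite /coword /image_mem eE map_cat /= !mnmE !eqxx.
have /negbTE -> : j != i by apply/eqP => E; move: ji; rewrite E; lia.
congr (_ ++ _ :: _ :: _); apply/eq_in_map => k kin; rewrite mnmE.
- have := He k kin; case: eqP => [->|_]; first by lia.
  by case: eqP => [->|_] //; lia.
have := Hr k kin; case: eqP => [->|_]; first by lia.
by case: eqP => [->|_] //; lia.
Qed.

(** The new first letter is positive in both cases, which is all that the
    profile depends on. *)
Lemma ddiff_support i j f m : j = i.+1 :> nat ->
  (forall m', m' \in msupp f -> under_staircase m') -> m \in msupp (ddiff i j f) ->
  under_staircase m /\ exists m' e p q x y r, [/\ m' \in msupp f,
    coword m' = e ++ p :: q :: r, coword m = e ++ x :: y :: r,
    size e = i & (x + y = (p + q).+1)%N /\ ((p < x <= q.+1) || (q.+1 < x <= p))%N].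
Proof.
move=> ji us; rewrite mcoeff_msupp -{1}(set_exp_id i j m) => G0.
have ij : i != j by apply/eqP => E; move: ji; rewrite E; lia.
have [c [d [E Fcd mn mx]]] := ddiff_coeff_support ij G0.
set m' := set_exp i j m c d in Fcd.
have m'f : m' \in msupp f by rewrite mcoeff_msupp.
have /forallP u := us _ m'f.
have := u i; have := u j; rewrite !mnmE !eqxx eq_sym (negbTE ij) => dle cle.
have lj := ltn_ord j.
split.
  apply/forallP => k; have := u k; rewrite mnmE.
  have [->|_] := eqVneq k i; first by lia.
  by have [->|_] := eqVneq k j; first by lia.
have [e [r [sz cE]]] := coword_set_exp m ji.
exists m', e, (n - i.+1 - c)%N, (n - j.+1 - d)%N, (n - i.+1 - m i)%N, (n - j.+1 - m j)%N, r.
split=> //; [exact: cE | by rewrite -cE set_exp_id | split; lia].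
Qed.

End DividedDifference.

(** * Words of permutations *)

Definition line n (w : 'S_n) : seq nat := [seq val (w k) | k <- enum 'I_n].

Definition word n (w : 'S_n) : seq nat := code (line w).

Section Words.
Variable n : nat.
Implicit Types (w u v : 'S_n) (i j k : 'I_n).

Lemma size_line w : size (line w) = n.
Proof. by rewrite size_map size_enum_ord. Qed.

Lemma size_word w : size (word w) = n.
Proof. by rewrite size_code size_line. Qed.

Lemma line_inj w w' : line w = line w' -> w = w'.
Proof.
move=> E; apply/permP => k; have /eq_in_map/(_ k) := E.
by rewrite mem_enum => /(_ isT)/val_inj.
Qed.

Lemma uniq_line w : uniq (line w).
Proof. by rewrite map_inj_uniq ?enum_uniq // => i j /val_inj/perm_inj. Qed.

Lemma mem_line w a : (a \in line w) = (a < n)%N.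
Proof.
apply/mapP/idP => [[k _ ->]|lt]; first exact: ltn_ord.
by exists (w^-1 (Ordinal lt))%g; rewrite ?mem_enum ?permKV.
Qed.

Lemma drop_enum k : drop k.+1 (enum 'I_n) = [seq j : 'I_n <- enum 'I_n | (k < j)%N].
Proof.
apply: (inj_map val_inj); rewrite map_drop -[RHS](filter_map val (fun x => k < x)%N) val_enum_ord.
rewrite drop_iota add0n; have lt := ltn_ord k.
have -> : iota 0 n = iota 0 k.+1 ++ iota k.+1 (n - k.+1) by rewrite -iotaD; congr iota; lia.
rewrite filter_cat (@eq_in_filter _ _ pred0) ?filter_pred0 => [|x].
  by apply/esym/all_filterP/allP => x; rewrite mem_iota; lia.
by rewrite mem_iota /=; lia.
Qed.

Lemma nth_line w k : nth 0%N (line w) k = w k.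
Proof. by rewrite (nth_map k) ?size_enum_ord // nth_ord_enum. Qed.

Lemma card_count (A : {set 'I_n}) : #|A| = count (mem A) (enum 'I_n).
Proof.
rewrite cardE -size_filter; apply/perm_size/uniq_perm; [exact: enum_uniq|exact/filter_uniq/enum_uniq|].
by move=> j; rewrite mem_enum mem_filter mem_enum andbT.
Qed.

Lemma nth_word w k : nth 0%N (word w) k = #|[set j : 'I_n | (k < j)%N && (w k < w j)%N]|.
Proof.
rewrite nth_code ?size_line // nth_line /line -map_drop count_map drop_enum count_filter.
by rewrite card_count; apply: eq_count => j; rewrite !inE /= andbC.
Qed.

Lemma lehmerE w k : (lehmer w k + nth 0%N (word w) k = n - k.+1)%N.
Proof.
rewrite nth_word mnmE -cardsUI.
have -> : [set j : 'I_n | (k < j)%N && (w j < w k)%N] :&: [set j : 'I_n | (k < j)%N && (w k < w j)%N] = set0.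
  by apply/setP => j; rewrite !inE; lia.
rewrite cards0 addn0.
transitivity (size (drop k.+1 (enum 'I_n))); last by rewrite size_drop size_enum_ord.
rewrite drop_enum size_filter card_count; apply: eq_count => j.
rewrite !inE /= -andb_orr; case: (ltnP k j) => //= kj.
have : nat_of_ord (w j) != nat_of_ord (w k).
  by apply/eqP => /val_inj/perm_inj E; move: kj; rewrite E ltnn.
by case: ltngtP.
Qed.

Lemma coword_lehmer w : coword (lehmer w) = word w.
Proof.
apply: (@eq_from_nth _ 0%N) => [|k]; rewrite size_coword ?size_word // => lt.
by have := lehmerE w (Ordinal lt); have := nth_coword (lehmer w) (Ordinal lt) => /= ->; lia.
Qed.

Lemma lehmer_under w : under_staircase (lehmer w).
Proof. by apply/forallP => k; have := lehmerE w k; lia. Qed.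

Lemma bounded_word w : bounded (word w).
Proof. exact: bounded_code. Qed.

Lemma word_inj u w : word u = word w -> u = w.
Proof.
move=> E; apply: line_inj; apply: code_inj E; last exact: uniq_line.
by apply: uniq_perm; rewrite ?uniq_line // => a; rewrite !mem_line.
Qed.

Lemma word_swap w i j : j = i.+1 :> nat -> (w i < w j)%N ->
  exists e p q r, [/\ size e = i, (p <= q)%N, word w = e ++ q.+1 :: p :: r &
                     word (tperm i j * w)%g = e ++ p :: q :: r].
Proof.
move=> ji asc; have [e [r [eE sz He Hr]]] := enum_adjacent ji.
rewrite /word /line eE !map_cat /= !permM tpermL tpermR.
have E s : (forall k, k \in s -> (k < i) || (j < k))%N ->
    [seq val ((tperm i j * w)%g k) | k <- s] = [seq val (w k) | k <- s].
  move=> H; apply/eq_in_map => k /H lt; rewrite permM tpermD //.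
    by apply/eqP => E; move: lt; rewrite -E; lia.
  by apply/eqP => E; move: lt; rewrite -E; lia.
have -> := E e; last by move=> k kin; rewrite (He k kin).
have -> := E r; last by move=> k kin; rewrite (Hr k kin) orbT.
have [e' [p [q [r' [sz' pq -> ->]]]]] := code_swap [seq val (w k) | k <- e] [seq val (w k) | k <- r] asc.
by exists e', p, q, r'; rewrite sz' size_map.
Qed.

End Words.

Lemma line_surj n s : perm_eq s (iota 0 n) -> exists w : 'S_n, line w = s.
Proof.
move=> sp; have sz : size s = n by rewrite (perm_size sp) size_iota.
have lt (k : 'I_n) : (nth 0%N s k < n)%N.
  have : nth 0%N s k \in s by rewrite mem_nth ?sz.
  by rewrite (perm_mem sp) mem_iota.
have inj : injective (fun k => Ordinal (lt k)).
  move=> k l /(congr1 val) /= /eqP; rewrite nth_uniq ?sz ?(perm_uniq sp) ?iota_uniq //.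
  by move=> /eqP/val_inj.
exists (perm inj); apply: (@eq_from_nth _ 0%N) => [|k]; rewrite size_line ?sz // => kn.
by rewrite (nth_line _ (Ordinal kn)) permE.
Qed.

Lemma word_surj n c : bounded c -> size c = n -> exists w : 'S_n, word w = c.
Proof.
move=> /code_surj[s [sp cE]] sz; rewrite sz in sp.
by have [w wE] := line_surj sp; exists w; rewrite /word wE.
Qed.

(** * Schubert polynomials along arbitrary ascents *)

Section Schubert.
Variable n : nat.
Implicit Types (w u v : 'S_n) (i j k : 'I_n) (m : 'X_{1..n}).

Definition ascent i j w := (j == i.+1 :> nat) && (w i < w j)%N.

(** The number of recursion steps from a permutation to the longest one. *)
Definition noninv w := sumn (word w).

Lemma noninv_swap i j w : ascent i j w -> noninv w = (noninv (tperm i j * w)%g).+1.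
Proof.
case/andP=> /eqP ji asc; have [e [p [q [r [_ _]]]]] := word_swap ji asc.
by rewrite /noninv => -> ->; rewrite !sumn_cat /=; lia.
Qed.

Lemma noninv_bin w : (noninv w <= 'C(n, 2))%N.
Proof. by have := sumn_bounded (bounded_word w); rewrite size_word. Qed.

Lemma schubert_recS (a : nat) w : schubert_rec a.+1 w =
  if [pick p : 'I_n * 'I_n | (p.2 == p.1.+1 :> nat) && (w p.1 < w p.2)%N] is Some p
  then ddiff p.1 p.2 (schubert_rec a (tperm p.1 p.2 * w)%g)
  else 'X_[[multinom (n - i.+1)%N | i < n]].
Proof. by []. Qed.

(** The recursion stops by itself at the longest permutation, so additional
    steps do not matter. *)
Lemma schubert_rec_stable (a b : nat) w : (noninv w <= a)%N -> (noninv w <= b)%N ->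
  schubert_rec a w = schubert_rec b w.
Proof.
elim: a b w => [|a IHa] [|b] w wa wb; first by [].
- rewrite [RHS]schubert_recS; case: pickP => [p asc|_]; last by [].
  by have := noninv_swap asc; lia.
- rewrite [LHS]schubert_recS; case: pickP => [p asc|_]; last by [].
  by have := noninv_swap asc; lia.
rewrite !schubert_recS; case: pickP => [p asc|_]; last by [].
by congr ddiff; apply: IHa; rewrite -ltnS -(noninv_swap asc).
Qed.

Lemma schubertP w :
  (exists i j, ascent i j w /\ schubert w = ddiff i j (schubert (tperm i j * w)%g)) \/
  ((forall i j, ~~ ascent i j w) /\ schubert w = 'X_[[multinom (n - i.+1)%N | i < n]]).
Proof.
rewrite /schubert (schubert_rec_stable (noninv_bin w) (leqnSn _)) schubert_recS.
case: pickP => [p asc|noasc]; [left|right].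
  exists p.1, p.2; split; first exact: asc.
  congr ddiff; apply: schubert_rec_stable (noninv_bin _).
  by rewrite -ltnS -(noninv_swap asc).
by split; last exact: erefl; move=> i j; apply/negbT/(noasc (i, j)).
Qed.

Lemma ascent_neq i j w : ascent i j w -> i != j.
Proof. by case/andP=> /eqP ji _; apply/eqP => E; move: ji; rewrite E; lia. Qed.

(** Two distinct ascents can be resolved in either order, up to a commutation
    or a braid relation. *)
Lemma schubert_diamond w :
  (forall v, (noninv v < noninv w)%N -> forall i j, ascent i j v ->
     schubert v = ddiff i j (schubert (tperm i j * v)%g)) ->
  forall i j k l, ascent i j w -> ascent k l w -> (i < k)%N ->
  ddiff i j (schubert (tperm i j * w)%g) = ddiff k l (schubert (tperm k l * w)%g).
Proof.
move=> IH i j k l aij akl ik.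
have lij := noninv_swap aij; have lkl := noninv_swap akl.
have nij := ascent_neq aij; have nkl := ascent_neq akl.
case/andP: (aij) => /eqP ji wij; case/andP: (akl) => /eqP lk wkl.
have nik : i != k by apply/eqP => E; move: ik; rewrite E; lia.
have nil : i != l by apply/eqP => E; move: ik; rewrite E; lia.
have nji : j != i by rewrite eq_sym.
have nki : k != i by rewrite eq_sym.
have nli : l != i by rewrite eq_sym.
have njl : j != l by apply/eqP => E; move: ik; rewrite -E in lk; lia.
have [jk|njk] := eqVneq j k.
  rewrite -jk in akl lkl nkl lk wkl nik *.
  have a1 : ascent j l (tperm i j * w)%g.
    by rewrite /ascent lk eqxx /= !permM tpermR (tpermD nil njl); apply: ltn_trans wkl.
  have a2 : ascent i j (tperm j l * (tperm i j * w))%g.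
    by rewrite /ascent ji eqxx /= !permM tpermL (tpermD nji nli) tpermL (tpermD nil njl).
  have a3 : ascent i j (tperm j l * w)%g.
    by rewrite /ascent ji eqxx /= !permM tpermL (tpermD nji nli); apply: ltn_trans wkl.
  have a4 : ascent j l (tperm i j * (tperm j l * w))%g.
    by rewrite /ascent lk eqxx /= !permM tpermR (tpermD nji nli) (tpermD nil njl) tpermR.
  have l1 := noninv_swap a1; have l3 := noninv_swap a3.
  have /IH/(_ _ _ a1) E1 : (noninv (tperm i j * w)%g < noninv w)%N by rewrite lij.
  have /IH/(_ _ _ a2) E2 : (noninv (tperm j l * (tperm i j * w))%g < noninv w)%N.
    by rewrite lij l1 ltnS leqnSn.
  have /IH/(_ _ _ a3) E3 : (noninv (tperm j l * w)%g < noninv w)%N by rewrite lkl.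
  have /IH/(_ _ _ a4) E4 : (noninv (tperm i j * (tperm j l * w))%g < noninv w)%N.
    by rewrite lkl l3 ltnS leqnSn.
  have B : (tperm i j * (tperm j l * (tperm i j * w)) = tperm j l * (tperm i j * (tperm j l * w)))%g.
    by rewrite !mulgA -!(mulgA (tperm _ _) (tperm _ _) (tperm _ _)) tperm_braid.
  rewrite E1 E2 B E3 E4; exact: ddiff_braid.
have a1 : ascent k l (tperm i j * w)%g.
  by rewrite /ascent lk eqxx /= !permM !tpermD.
have a2 : ascent i j (tperm k l * w)%g.
  by rewrite /ascent ji eqxx /= !permM !tpermD 1?eq_sym.
have /IH/(_ _ _ a1) E1 : (noninv (tperm i j * w)%g < noninv w)%N by rewrite lij.
have /IH/(_ _ _ a2) E2 : (noninv (tperm k l * w)%g < noninv w)%N by rewrite lkl.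
have njk' : j != k by [].
have B : (tperm i j * (tperm k l * w) = tperm k l * (tperm i j * w))%g.
  by rewrite !mulgA (tperm_commute nik nil njk' njl).
rewrite E1 E2 B; exact: ddiffC.
Qed.

Theorem schubert_ascent i j w : ascent i j w ->
  schubert w = ddiff i j (schubert (tperm i j * w)%g).
Proof.
move: {2}(noninv w).+1 (ltnSn (noninv w)) => N.
elim: N w i j => // N IHN w i j lt aij.
have IH v : (noninv v < noninv w)%N -> forall i j, ascent i j v ->
     schubert v = ddiff i j (schubert (tperm i j * v)%g).
  by move=> lv i' j'; apply: IHN; lia.
have [[k [l [akl ->]]]|[noasc _]] := schubertP w; last by have := noasc i j; rewrite aij.
have [lt_ik|lt_ki|ik] := ltngtP i k.
- by apply: esym; apply: schubert_diamond.
- exact: schubert_diamond.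
have E : i = k by apply: val_inj.
case/andP: aij => /eqP ji _; case/andP: akl => /eqP lk _.
have -> : j = l by apply: val_inj; rewrite /= ji lk ik.
by rewrite E.
Qed.

Lemma ascent_word i j w e x y r : j = i.+1 :> nat -> size e = i ->
  word w = e ++ x :: y :: r -> (w i < w j)%N = (y < x)%N.
Proof.
move=> ji sz wE.
have [lt|le] := ltnP (w i) (w j).
  have [e' [p [q [r' [sz' pq E _]]]]] := word_swap ji lt.
  move: E; rewrite wE => /eqP; rewrite eqseq_cat ?sz ?sz' // => /andP[_ /eqP[-> -> _]]; lia.
have lt : ((tperm i j * w)%g i < (tperm i j * w)%g j)%N.
  rewrite !permM tpermL tpermR ltn_neqAle le andbT; apply/eqP => /val_inj/perm_inj E.
  by move: ji; rewrite E; lia.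
have [e' [p [q [r' [sz' pq _]]]]] := word_swap ji lt.
rewrite mulgA tperm2 mul1g wE => /eqP; rewrite eqseq_cat ?sz ?sz' // => /andP[_ /eqP[-> -> _]]; lia.
Qed.

Lemma word_positions w e x y r : word w = e ++ x :: y :: r ->
  exists i j, size e = i /\ j = i.+1 :> nat.
Proof.
move=> E; have := size_word w; rewrite E size_cat /= => sz.
have li : (size e < n)%N by lia. have lj : ((size e).+1 < n)%N by lia.
by exists (Ordinal li), (Ordinal lj).
Qed.

Lemma word_swapE w e x y r : word w = e ++ x :: y :: r -> (y < x)%N ->
  exists i j, [/\ j = i.+1 :> nat, size e = i, schubert w = ddiff i j (schubert (tperm i j * w)%g) &
   word (tperm i j * w)%g = e ++ y :: x.-1 :: r].
Proof.
move=> wE lt; have [i [j [sz ji]]] := word_positions wE.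
have asc := ascent_word ji sz wE; rewrite lt in asc.
exists i, j; split=> //; first by apply: schubert_ascent; rewrite /ascent ji eqxx asc.
have [e' [p [q [r' [sz' _ E ->]]]]] := word_swap ji asc.
by move: E; rewrite wE => /eqP; rewrite eqseq_cat ?sz ?sz' // => /andP[/eqP-> /eqP[-> -> ->]].
Qed.

Lemma schubert_noascent w : word w = nseq n 0%N -> schubert w = 'X_[lehmer w].
Proof.
move=> wE; have [[i [j [asc _]]]|[_ ->]] := schubertP w.
  by have := noninv_swap asc; rewrite /noninv wE sumn_nseq mul0n.
congr 'X_[_]; apply/mnmP => k; have := lehmerE w k; rewrite wE nth_nseq mnmE if_same; lia.
Qed.

Lemma schubert_ind (P : 'S_n -> Prop) :
  (forall w, (forall v, (noninv v < noninv w)%N -> P v) -> P w) -> forall w, P w.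
Proof.
move=> IH w; move: {2}(noninv w).+1 (ltnSn (noninv w)) => N.
by elim: N w => // N IHN w lt; apply: IH => v lv; apply: IHN; lia.
Qed.

(** * Monomials of a Schubert polynomial *)

Lemma schubert_under w m : m \in msupp (schubert w) -> under_staircase m.
Proof.
elim/schubert_ind: w m => w IH m.
have [E|[e [x [s E]]]] := last_descent (bounded_word w).
  rewrite size_word in E; rewrite (schubert_noascent E) msuppX inE => /eqP ->.
  exact: lehmer_under.
have [i [j [ji sz -> vE]]] := word_swapE E (ltn0Sn _).
have lt : (noninv (tperm i j * w)%g < noninv w)%N by rewrite /noninv E vE !sumn_cat /=; lia.
by case/(ddiff_support ji (IH _ lt)).
Qed.

(** All monomials of the previous Schubert polynomial have the same profile
    by induction, and a divided difference changes it in the same way for each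
    of them. *)
Lemma schubert_profile w m : m \in msupp (schubert w) -> profile (coword m) = profile (word w).
Proof.
elim/schubert_ind: w m => w IH m.
have [E|[e [x [s E]]]] := last_descent (bounded_word w).
  rewrite size_word in E; rewrite (schubert_noascent E) msuppX inE => /eqP ->.
  by rewrite coword_lehmer.
have [i [j [ji sz -> vE]]] := word_swapE E (ltn0Sn _).
have lt : (noninv (tperm i j * w)%g < noninv w)%N by rewrite /noninv E vE !sumn_cat /=; lia.
case/(ddiff_support ji (@schubert_under _)) => _ [m' [e' [p [q [a [b [r [m'S cE' cE sz' [S ab]]]]]]]]].
have := IH _ lt _ m'S; rewrite cE cE' E vE => P.
by apply: (profile_exchange _ P); lia.
Qed.

(** Use the last ascent: then the previous permutation has first letter 0 in
    the pair and only zeros after it. A monomial of its polynomial that agrees with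
    it before the pair cannot have a smaller letter there, so its second letter
    is not larger either. *)
Lemma schubert_lex w m : m \in msupp (schubert w) -> lexle (coword m) (word w).
Proof.
elim/schubert_ind: w m => w IH m.
have [E|[e [x [s E]]]] := last_descent (bounded_word w).
  rewrite size_word in E; rewrite (schubert_noascent E) msuppX inE => /eqP ->.
  by rewrite coword_lehmer lexle_refl.
have [i [j [ji sz -> vE]]] := word_swapE E (ltn0Sn _).
have lt : (noninv (tperm i j * w)%g < noninv w)%N by rewrite /noninv E vE !sumn_cat /=; lia.
case/(ddiff_support ji (@schubert_under _)) => _ [m' [e' [p [q [a [b [r [m'S cE' cE sz' [S ab]]]]]]]]].
have := IH _ lt _ m'S; rewrite cE cE' E vE => /lexle_cat; rewrite sz sz' => /(_ erefl).
case=> [[-> /=]|[_ H]]; last exact: H.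
move=> /andP[/eqP p0] le; rewrite lexle_catl /=; subst p.
have szr : size r = s.
  have := size_coword m'; rewrite cE' -(size_word (tperm i j * w)%g) vE !size_cat sz sz' /= size_nseq; lia.
case/orP: le => [lt'|/andP[/eqP q0 le]]; first by apply/orP; left; lia.
rewrite (lexle_nil0 szr le) lexle_refl; lia.
Qed.

Lemma coeff_lex0 w m : ~~ lexle (coword m) (word w) -> (schubert w)@_m = 0.
Proof. by move=> H; apply/eqP; rewrite mcoeff_eq0; apply: contra H; apply: schubert_lex. Qed.

Lemma lehmer_adjacent w i j e x y r : j = i.+1 :> nat -> size e = i -> word w = e ++ x :: y :: r ->
  [/\ (lehmer w i = n - i.+1 - x)%N, (lehmer w j = n - j.+1 - y)%N & forall a b,
   coword (set_exp i j (lehmer w) a b) = e ++ (n - i.+1 - a)%N :: (n - j.+1 - b)%N :: r].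
Proof.
move=> ji sz wE.
have Ei := lehmerE w i; have Ej := lehmerE w j.
have [e' [r' [sz' H]]] := coword_set_exp (lehmer w) ji.
have := H (lehmer w i) (lehmer w j); rewrite set_exp_id coword_lehmer wE => /eqP.
rewrite eqseq_cat ?sz ?sz' // => /andP[/eqP eE /eqP[_ _ rE]].
split; last by move=> a b; rewrite H eE rE.
- by move: Ei; rewrite wE nth_cat sz ltnn subnn /=; lia.
by move: Ej; rewrite wE nth_cat sz ji ltnNge leqnSn /= subSn // subnn /=; lia.
Qed.

Lemma bounded_adjacent w i j e x y r : j = i.+1 :> nat -> size e = i -> word w = e ++ x :: y :: r ->
  (x <= n - i.+1)%N /\ (y <= n - j.+1)%N.
Proof.
move=> ji sz wE; have := bounded_word w; have := size_word w.
by rewrite wE size_cat /= => sE /bounded_catr /= /and3P[]; lia.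
Qed.

Lemma lehmer_set_exp w u i j e x y p q r : j = i.+1 :> nat -> size e = i ->
  word w = e ++ x :: y :: r -> word u = e ++ p :: q :: r ->
  lehmer u = set_exp i j (lehmer w) (n - i.+1 - p) (n - j.+1 - q).
Proof.
move=> ji sz wE uE; have [lp lq] := bounded_adjacent ji sz uE.
have [_ _ H] := lehmer_adjacent ji sz wE.
apply: coword_inj; first exact: lehmer_under.
  by apply: under_set_exp; rewrite ?leq_subr //; exact: lehmer_under.
by rewrite coword_lehmer uE H !subKn.
Qed.

(** With the last ascent, all other terms of the recursion along the string
    vanish for lexicographic reasons. *)
Lemma schubert_lead w : (schubert w)@_(lehmer w) = 1.
Proof.
elim/schubert_ind: w => w IH.
have [E|[e [x [s E]]]] := last_descent (bounded_word w).
  by rewrite size_word in E; rewrite (schubert_noascent E) mcoeffX eqxx.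
have [i [j [ji sz wE vE]]] := word_swapE E (ltn0Sn _).
have lt : (noninv (tperm i j * w)%g < noninv w)%N by rewrite /noninv E vE !sumn_cat /=; lia.
have one := IH _ lt; rewrite (lehmer_set_exp ji sz E vE) in one.
have [Ei Ej H] := lehmer_adjacent ji sz E.
have [le _] := bounded_adjacent ji sz E.
have ij : i != j by apply/eqP => F; move: ji; rewrite F; lia.
have F0 a b : (a < n - i.+1)%N -> (schubert (tperm i j * w)%g)@_(set_exp i j (lehmer w) a b) = 0.
  move=> la; apply: coeff_lex0; rewrite H vE lexle_catl /=.
  by have -> : (n - i.+1 - a)%N = (n - i.+1 - a).-1.+1 by lia.
have G0 a b : (a < lehmer w i)%N -> (schubert w)@_(set_exp i j (lehmer w) a b) = 0.
  move=> la; apply: coeff_lex0; rewrite H E lexle_catl /= negb_or negb_and.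
  by apply/andP; split; [|apply/orP; left]; lia.
rewrite -(set_exp_id i j (lehmer w)).
rewrite subn0 /= in one.
have Ej' : (lehmer w j).+1 = (n - i.+1)%N by lia.
have Ea : (n - j.+1 - x = lehmer w i)%N by lia.
rewrite -Ej' Ea in one F0.
case: (lehmer w i) Ei le one F0 G0 Ea => [|a] Ei le one F0 G0 Ea.
  by rewrite wE ddiff_coeff0 // one F0 ?subr0.
have := ddiff_coeffS ij (schubert (tperm i j * w)%g) (lehmer w) a (lehmer w j).
rewrite -wE G0 // F0 ?one; last by lia.
by rewrite !sub0r => /oppr_inj.
Qed.

(** Inside the string, triangularity of the previous Schubert polynomial makes
    the increments of the coefficients vanish, so that they all equal the
    leading coefficient. *)
Lemma schubert_string w u e x y p q r :
  word w = e ++ x :: y :: r -> word u = e ++ p :: q :: r ->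
  (p + q = x + y)%N -> (y < p <= x)%N -> (schubert w)@_(lehmer u) = 1.
Proof.
move=> E uE S /andP[yp px].
have [i [j [ji sz wE vE]]] := word_swapE E (leq_trans yp px).
rewrite (lehmer_set_exp ji sz E uE).
have [Ei Ej H] := lehmer_adjacent ji sz E.
have [le le'] := bounded_adjacent ji sz E; have [lek lel] := bounded_adjacent ji sz uE.
have ij : i != j by apply/eqP => F; move: ji; rewrite F; lia.
have F0 a b : (a + y < n - i.+1)%N -> (schubert (tperm i j * w)%g)@_(set_exp i j (lehmer w) a b) = 0.
  move=> la; apply: coeff_lex0; rewrite H vE lexle_catl /= negb_or negb_and.
  by apply/andP; split; [|apply/orP; left]; lia.
(* walk from the leading monomial, decreasing the first letter *)
suff C t : (t < x - y)%N ->
    (schubert w)@_(set_exp i j (lehmer w) (n - i.+1 - x + t) (n - j.+1 - y - t)) = 1.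
  have -> : (n - i.+1 - p = n - i.+1 - x + (x - p))%N by lia.
  have -> : (n - j.+1 - q = n - j.+1 - y - (x - p))%N by lia.
  by apply: C; lia.
elim: t => [|t IHt] lt.
  by rewrite addn0 subn0 -Ei -Ej set_exp_id schubert_lead.
have := ddiff_coeffS ij (schubert (tperm i j * w)%g) (lehmer w) (n - i.+1 - x + t) (n - j.+1 - y - t.+1).
have lj := ltn_ord j.
have z1 : ((n - i.+1 - x + t).+1 + y < n - i.+1)%N by lia.
have z2 : ((n - j.+1 - y - t.+1).+1 + y < n - i.+1)%N by lia.
rewrite -wE (F0 _ _ z1) (F0 _ _ z2).
have -> : (n - j.+1 - y - t.+1).+1 = (n - j.+1 - y - t)%N by lia.
rewrite IHt; last by lia.
by rewrite subrr -addnS => /eqP; rewrite subr_eq0 => /eqP.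
Qed.

(** Use the first ascent: the two letters differ by one, so that the divided
    difference maps a monomial to a monomial, and drops stay small. *)
Lemma schubert_dominant w : no_big_drop (word w) -> schubert w = 'X_[lehmer w].
Proof.
elim/schubert_ind: w => w IH nb.
have [so|/first_descent[e [x [y [r [E yx so]]]]]] := boolP (sorted leq (word w)).
  have [E|[e [x [s E]]]] := last_descent (bounded_word w).
    by rewrite size_word in E; exact: schubert_noascent.
  by move: so; rewrite E => /cat_sorted2[_].
have xE : x = y.+1.
  by move: (nb); rewrite E => /no_big_drop_catr /= /andP[+ _]; lia.
subst x; have [i [j [ji sz wE vE]]] := word_swapE E yx.
have lt : (noninv (tperm i j * w)%g < noninv w)%N by rewrite /noninv E vE !sumn_cat /=; lia.
have nbv : no_big_drop (word (tperm i j * w)%g).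
  by rewrite vE; apply: no_big_drop_lower so; rewrite -E.
rewrite wE (IH _ lt nbv).
have [Ei Ej H] := lehmer_adjacent ji sz E.
have [le le'] := bounded_adjacent ji sz E.
have ij : i != j by apply/eqP => F; move: ji; rewrite F; lia.
rewrite (lehmer_set_exp ji sz E vE) /=.
have -> : (n - i.+1 - y)%N = (lehmer w i).+1 by lia.
have -> : (n - j.+1 - y)%N = lehmer w j by lia.
rewrite set_expSl set_exp_id ddiff_X //; lia.
Qed.

(** * The edges and the weak components *)

Lemma edge_support u w : pieri_edge u w -> lehmer u \in msupp (schubert w).
Proof. by case/andP=> _ c0; rewrite mcoeff_msupp; apply: contraTneq c0 => ->. Qed.

Lemma edge_profile u w : pieri_edge u w -> profile (word u) = profile (word w).
Proof. by move=> /edge_support/schubert_profile; rewrite coword_lehmer. Qed.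

(** With [edge_profile], edges climb lexicographically inside a profile class. *)
Lemma edge_lex u w : pieri_edge u w -> lexle (word u) (word w).
Proof. by move=> /edge_support/schubert_lex; rewrite coword_lehmer. Qed.

Lemma edge_string u w e x y p q r :
  word w = e ++ x :: y :: r -> word u = e ++ p :: q :: r ->
  (p + q = x + y)%N -> (y < p <= x)%N -> u = w \/ pieri_edge u w.
Proof.
move=> wE uE S yp; have [->|ne] := eqVneq u w; first by left.
by right; rewrite /pieri_edge ne (schubert_string wE uE).
Qed.

Lemma dominant_source u w : no_big_drop (word w) -> ~~ pieri_edge u w.
Proof.
move=> /schubert_dominant E; apply/negP => uw; move: (edge_support uw).
rewrite E msuppX inE => /eqP L; move: uw; rewrite /pieri_edge.
have -> : u = w by apply: word_inj; rewrite -!coword_lehmer L.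
by rewrite eqxx.
Qed.

Definition pieri_adj := [rel u w : 'S_n | pieri_edge u w || pieri_edge w u].

Lemma pieri_adj_sym : connect_sym pieri_adj.
Proof. by apply: sym_connect_sym => u w; rewrite /= orbC. Qed.

Lemma edge_connect u w : u = w \/ pieri_edge u w -> connect pieri_adj u w.
Proof. by case=> [->|uw]; [exact: connect0 | apply: connect1; rewrite /= uw]. Qed.

(** Both words of a local move are joined to the same permutation, namely to
    the one in which the first of the two letters is as large as possible. *)
Lemma linked_connect c d : linked c d -> bounded c ->
  forall u w, word u = c -> word w = d -> connect pieri_adj u w.
Proof.
elim=> {c d} [c|c d _ IH|c d e L1 IH1 L2 IH2|e a b a' b' r S a0 a0' bd bd'] bc u w uE wE.
- by rewrite (word_inj (etrans uE (esym wE))) connect0.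
- rewrite pieri_adj_sym; apply: IH => //; by rewrite -wE bounded_word.
- have bd : bounded d by rewrite -(linked_bounded L1).
  have [|v vE] := @word_surj n d bd; first by rewrite -(linked_size L1) -uE size_word.
  by apply: (connect_trans (IH1 bc u v uE vE)); apply: IH2.
have /= /and3P[la lb br] := bounded_catr bd; have /= /and3P[la' lb' _] := bounded_catr bd'.
(* [size r + 1] is the bound on the first letter *)
pose x := minn (a + b) (size r).+1; pose y := (a + b - x)%N.
have bx : bounded (e ++ x :: y :: r).
  by apply: bounded_cat_swap bd => //=; rewrite br andbT /y /x; lia.
have [|v vE] := @word_surj n _ bx; first by rewrite -(size_word u) uE !size_cat.
apply: (@connect_trans _ _ v).
  by apply: edge_connect; apply: (edge_string vE uE); rewrite /y /x; lia.
rewrite pieri_adj_sym; apply: edge_connect; apply: (edge_string vE wE); rewrite /y /x; lia.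
Qed.

Theorem connect_profile u w :
  connect pieri_adj u w = (profile (word u) == profile (word w)).
Proof.
apply/idP/eqP => [/connectP[p]|E].
  elim: p u => [|v p IHp] u /= => [_ ->//|/andP[uv pv] wE].
  by rewrite -(IHp v pv wE); case/orP: uv => /edge_profile.
apply: (linked_connect (linked_profile _ _ E)) => //; exact: bounded_word.
Qed.

End Schubert.

Local Close Scope ring_scope.

(** * Pattern-avoiding representatives *)

Section Patterns.
Variable n : nat.
Implicit Types (w u v : 'S_n) (p t : seq nat).

Lemma ord_ltn_trans : transitive (fun i j : 'I_n => i < j).
Proof. by move=> j i k; apply: ltn_trans. Qed.

Lemma sorted_enum m : sorted (fun i j : 'I_m => i < j) (enum 'I_m).
Proof. by have := iota_ltn_sorted 0 m; rewrite -val_enum_ord sorted_map. Qed.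

(** Occurrences of a pattern are increasing sequences of positions. *)
Lemma sorted_subseq_enum (s : seq 'I_n) : sorted (fun i j : 'I_n => i < j) s -> subseq s (enum 'I_n).
Proof.
move=> so; suff -> : s = filter (mem s) (enum 'I_n) by exact: filter_subseq.
apply: (irr_sorted_eq ord_ltn_trans) => //; first by move=> i; exact: ltnn.
- exact: (sorted_filter ord_ltn_trans _ (sorted_enum n)).
by move=> i; rewrite mem_filter mem_enum andbT.
Qed.

Lemma containsP w p : contains w p <-> exists t, [/\ subseq t (line w), size t = size p &
  forall a b, a < size p -> b < size p -> (nth 0 t a < nth 0 t b) = (nth 0 p a < nth 0 p b)].
Proof.
split=> [/existsP[f /forallP F]|[t [st sz H]]].
  exists [seq val (w i) | i <- [seq f a | a <- enum 'I_(size p)]]; split.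
  - apply: map_subseq; apply: sorted_subseq_enum; rewrite sorted_map.
    apply: sub_sorted (sorted_enum (size p)) => a b ab.
    by have /forallP/(_ b)/andP[/implyP/(_ ab)] := F a.
  - by rewrite 2!size_map; exact: size_enum_ord.
  move=> a b la lb.
  have N (c : 'I_(size p)) : nth 0 [seq val (w i) | i <- [seq f a | a <- enum 'I_(size p)]] c = w (f c).
    rewrite -map_comp (nth_map c) ?size_enum_ord //=; congr (val (w (f _))).
    exact: nth_ord_enum.
  rewrite (N (Ordinal la)) (N (Ordinal lb)).
  by have /forallP/(_ (Ordinal lb))/andP[_ /eqP] := F (Ordinal la).
case/subseqP: st => m _ tE; set s := mask m (enum 'I_n).
have {}tE : t = [seq val (w i) | i <- s] by rewrite tE /line map_mask.
have szs : size s == size p by rewrite -sz tE size_map.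
have so : sorted (fun i j : 'I_n => i < j) s.
  by apply: (subseq_sorted ord_ltn_trans (mask_subseq _ _)); exact: sorted_enum.
pose T := Tuple szs.
have N (c : 'I_(size p)) : nth 0 t c = w (tnth T c).
  rewrite tE (nth_map (tnth T c)); last by rewrite (eqP szs).
  by congr (val (w _)); rewrite [RHS](tnth_nth (tnth T c)).
apply/existsP; exists [ffun c => tnth T c]; apply/forallP => a; apply/forallP => b.
rewrite !ffunE -!N H // eqxx andbT; apply/implyP => ab.
rewrite (tnth_nth (tnth T a)) (tnth_nth (tnth T a) T b).
by apply: (sorted_ltn_nth ord_ltn_trans) => //; rewrite inE (eqP szs).
Qed.

Lemma contains3P w p (P : nat -> nat -> nat -> bool) :
  (forall a b c, P a b c <-> forall i j, i < 3 -> j < 3 ->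
     (nth 0 [:: a; b; c] i < nth 0 [:: a; b; c] j) = (nth 0 p i < nth 0 p j)) ->
  size p = 3 -> ~~ contains w p <-> avoids3 P (line w).
Proof.
move=> HP sz; split=> [/negP nc a b c H /HP I|A]; first by apply/nc/containsP; exists [:: a; b; c]; split; rewrite ?sz.
apply/negP => /containsP[t [st]]; rewrite sz => szt I.
case: t => [|a [|b [|c [|? t]]]] // in st szt I.
by apply: (A _ _ _ st); apply/HP.
Qed.

Lemma contains4P w p (P : nat -> nat -> nat -> nat -> bool) :
  (forall a b c d, P a b c d <-> forall i j, i < 4 -> j < 4 ->
     (nth 0 [:: a; b; c; d] i < nth 0 [:: a; b; c; d] j) = (nth 0 p i < nth 0 p j)) ->
  size p = 4 -> ~~ contains w p <-> avoids4 P (line w).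
Proof.
move=> HP sz; split=> [/negP nc a b c d H /HP I|A]; first by apply/nc/containsP; exists [:: a; b; c; d]; split; rewrite ?sz.
apply/negP => /containsP[t [st]]; rewrite sz => szt I.
case: t => [|a [|b [|c [|d [|? t]]]]] // in st szt I.
by apply: (A _ _ _ _ st); apply/HP.
Qed.

Ltac pattern3 := apply: contains3P => // a b c; split=> [P [|[|[|i]]] [|[|[|j]]] //= _ _| H];
  [lia .. | have := H 0 1 isT isT; have := H 0 2 isT isT; have := H 1 2 isT isT;
            have := H 1 0 isT isT; have := H 2 0 isT isT; have := H 2 1 isT isT => /=; lia].

Lemma avoids132P w : ~~ contains w [:: 1; 3; 2] <-> avoids132 (line w).
Proof. pattern3. Qed.

Lemma avoids213P w : ~~ contains w [:: 2; 1; 3] <-> avoids213 (line w).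
Proof. pattern3. Qed.

Ltac pattern4 := apply: contains4P => // a b c d; split=> [P [|[|[|[|i]]]] [|[|[|[|j]]]] //= _ _| H];
  [lia .. | have := H 0 1 isT isT; have := H 0 2 isT isT; have := H 0 3 isT isT;
            have := H 1 2 isT isT; have := H 1 3 isT isT; have := H 2 3 isT isT;
            have := H 1 0 isT isT; have := H 2 0 isT isT; have := H 3 0 isT isT;
            have := H 2 1 isT isT; have := H 3 1 isT isT; have := H 3 2 isT isT => /=; lia].

Lemma avoids2341P w : ~~ contains w [:: 2; 3; 4; 1] <-> avoids2341 (line w).
Proof. pattern4. Qed.

Lemma avoids3124P w : ~~ contains w [:: 3; 1; 2; 4] <-> avoids3124 (line w).
Proof. pattern4. Qed.

Lemma avoids1423P w : ~~ contains w [:: 1; 4; 2; 3] <-> avoids1423 (line w).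
Proof. pattern4. Qed.

Lemma AplusP w : w \in Aplus n <-> plus_word (word w).
Proof.
rewrite inE /= andbT; split=> [/and3P[/avoids132P A /avoids2341P B /avoids3124P C]|].
  by apply: avoiding_plus_word (uniq_line w) _; split.
move=> H; have [A B C] := plus_word_avoiding H.
by apply/and3P; split; [apply/avoids132P|apply/avoids2341P|apply/avoids3124P].
Qed.

Lemma AminusP w : w \in Aminus n <-> minus_word (word w).
Proof.
rewrite inE /= andbT; split=> [/and3P[/avoids213P A /avoids2341P B /avoids1423P C]|].
  by apply: avoiding_minus_word (uniq_line w) _; split.
move=> H; have [A B C] := minus_word_avoiding H.
by apply/and3P; split; [apply/avoids213P|apply/avoids2341P|apply/avoids1423P].
Qed.

Lemma minus_inj u w : u \in Aminus n -> w \in Aminus n -> profile (word u) = profile (word w) -> u = w.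
Proof.
move=> /AminusP Mu /AminusP Mw P; apply: word_inj.
by apply: minus_unique; rewrite ?bounded_word ?size_word.
Qed.

Lemma plus_inj u w : u \in Aplus n -> w \in Aplus n -> profile (word u) = profile (word w) -> u = w.
Proof.
move=> /AplusP Mu /AplusP Mw P; apply: word_inj.
by apply: plus_unique; rewrite ?size_word.
Qed.

Lemma profile_representatives b : b \in profiles n ->
  exists u w, [/\ u \in Aminus n, w \in Aplus n, profile (word u) = b & profile (word w) = b].
Proof.
case/profiles_realized => c [d [Mc Pd [bc bd] [sc sd] [pc pd]]].
have [u uE] := word_surj bc sc; have [w wE] := word_surj bd sd.
by exists u, w; split; rewrite ?uE ?wE //; [apply/AminusP|apply/AplusP]; rewrite ?uE ?wE.
Qed.

Lemma profile_word_in w : profile (word w) \in profiles n.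
Proof. by have := profile_in_profiles (bounded_word w); rewrite size_word. Qed.

Lemma card_Aminus : #|Aminus n| = 2 ^ n - n.
Proof.
rewrite -size_profiles cardE -(size_map (fun w => profile (word w))); apply: perm_size.
apply: uniq_perm (uniq_profiles n) _.
  rewrite map_inj_in_uniq ?enum_uniq // => u w; rewrite !mem_enum; exact: minus_inj.
move=> b; apply/mapP/idP => [[w _ ->]|/profile_representatives[u [_ [uM _ uE _]]]].
  exact: profile_word_in.
by exists u; rewrite ?mem_enum.
Qed.

Lemma weak_componentsP (C : {set 'S_n}) : C \in weak_components n <->
  exists w, C = [set u | profile (word w) == profile (word u)].
Proof.
split=> [/imsetP[w _ ->]|[w ->]].
  by exists w; apply/setP => u; rewrite !inE connect_profile.
by apply/imsetP; exists w => //; apply/setP => u; rewrite !inE connect_profile.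
Qed.

(** The permutations in [Aminus] form a transversal of the components. *)
Lemma card_weak_components : #|weak_components n| = 2 ^ n - n.
Proof.
rewrite -card_Aminus; apply/esym/(@card_transversal _ _ _ [set: 'S_n]).
apply/and3P; split; last 1 first.
- apply/forall_inP => C /weak_componentsP[w ->]; apply/cards1P.
  have [u [_ [uM _ uE _]]] := profile_representatives (profile_word_in w).
  exists u; apply/setP => v; rewrite in_set1; apply/setIP/eqP => [[vM]|->].
    by rewrite inE => /eqP E; apply: minus_inj; rewrite // uE E.
  by split; rewrite // inE uE.
- apply: equivalence_partitionP => u v w _ _ _.
  by rewrite !connect_profile; split=> // /eqP->.
exact: subsetT.
Qed.

End Patterns.

Theorem theorem14p6 (N : nat) :
  #|weak_components N| = (2 ^ N - N)%N /\
  (forall C : {set 'S_N}, C \in weak_components N ->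
     (exists! w : 'S_N, w \in C :&: Aplus N) /\
     (exists! w : 'S_N, w \in C :&: Aminus N)) /\
  (forall w : 'S_N, w \in Aplus N -> is_source w) /\
  (forall w : 'S_N, w \in Aminus N -> is_sink w).
Proof.
split; first exact: card_weak_components.
split=> [C /weak_componentsP[w ->]|].
  have [u [v [uM vP uE vE]]] := profile_representatives (profile_word_in w).
  split.
    exists v; split=> [|x]; first by apply/setIP; rewrite inE vE.
    by case/setIP; rewrite inE => /eqP E xP; apply: plus_inj; rewrite // vE E.
  exists u; split=> [|x]; first by apply/setIP; rewrite inE uE.
  by case/setIP; rewrite inE => /eqP E xM; apply: minus_inj; rewrite // uE E.
split=> w.
  by move=> /AplusP/plus_no_big_drop nb u; exact: dominant_source.
move=> /AminusP M u; apply/negP => wu; have := wu; rewrite /pieri_edge.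
have -> : w = u; last by rewrite eqxx.
apply/word_inj/esym/minus_lexmax; rewrite ?bounded_word ?size_word //.
  by rewrite (edge_profile wu).
exact: edge_lex.
Qed.
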